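(* Let $R$ be a one-dimensional reduced semilocal Cohen–Macaulay ring. Then there is a decomposition into local value semigroups $$\Gamma_R=\prod_{\mathfrak{m}\in\operatorname{Max}(R)}\Gamma_{R_{\mathfrak{m}}},$$ and any regular fractional ideal $\mathcal{E}\in\mathfrak{R}_R$ decomposes as $$\Gamma_{\mathcal{E}}=\prod_{\mathfrak{m}\in\operatorname{Max}(R)}\Gamma_{\mathcal{E}_{\mathfrak{m}}}.$$
   Context: All rings are commutative and unitary; $\operatorname{Max}(R)$ is the set of maximal ideals of $R$. A one-dimensional Noetherian ring $R$ is Cohen–Macaulay if $\operatorname{depth}(R_{\mathfrak m})=1$ for all $\mathfrak m\in\operatorname{Max}(R)$. $Q_R$ is the total ring of fractions of $R$, $Q_R^{\mathrm{reg}}$ the set of its regular elements, and $T^{\mathrm{reg}}:=T\cap Q_R^{\mathrm{reg}}$ for $T\subseteq Q_R$. A fractional ideal of $R$ is an $R$-submodule $\mathcal{E}\subseteq Q_R$ with $r\mathcal{E}\subseteq R$ for some $r\in R^{\mathrm{reg}}$; it is regular if $\mathcal{E}^{\mathrm{reg}}\ne\emptyset$. $\mathfrak{R}_R$ is the set of regular fractional ideals. Let $R$ be a one-dimensional semilocal Cohen–Macaulay ring. $\mathfrak{V}_R$ is the set of valuation rings of $Q_R$ over $R$, i.e. subrings $V$ with $R\subseteq V\subsetneq Q_R$ such that $Q_R\setminus V$ is multiplicatively closed. This set is finite and nonempty; each $V\in\mathfrak{V}_R$ is a discrete valuation ring in the sense that it has a unique regular maximal ideal $\mathfrak{m}_V$,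 which is invertible and is the only regular prime ideal of $V$; moreover $\mathfrak{m}_V\cap R\in\operatorname{Max}(R)$. The associated discrete valuation $\nu_V\colon Q_R\to\mathbb{Z}\cup\{\infty\}$ is $\nu_V(x)=\max\{k\in\mathbb{Z}\mid x\in\mathfrak{m}_V^k\}$, with $\nu_V(x)=\infty$ if $x\in\bigcap_k\mathfrak{m}_V^k$. Set $\nu=(\nu_V)_{V\in\mathfrak{V}_R}$ and, for $\mathcal{E}\in\mathfrak{R}_R$, $\Gamma_{\mathcal{E}}:=\nu(\mathcal{E}^{\mathrm{reg}})\subseteq\mathbb{Z}^{\mathfrak{V}_R}$ (the value semigroup ideal of $\mathcal{E}$). The monoid $\Gamma_R$ is called local if $0$ is its only element with a zero component in $\mathbb{Z}^{\mathfrak{V}_R}$. Identification used: for reduced $R$, $(Q_R)_{\mathfrak{m}}=Q_{R_{\mathfrak{m}}}$ for $\mathfrak{m}\in\operatorname{Max}(R)$, $\mathcal{E}_{\mathfrak{m}}=\mathcal{E}R_{\mathfrak{m}}$ is a regular fractional ideal of $R_{\mathfrak{m}}$, and there is a bijection $\mathfrak{V}_R\to\bigsqcup_{\mathfrak{m}\in\operatorname{Max}(R)}\mathfrak{V}_{R_{\mathfrak{m}}}$, $V\mapsto V_{\mathfrak{m}_V\cap R}$, whose inverse sends $W\in\mathfrak{V}_{R_{\mathfrak{m}}}$ to its preimage under $Q_R\to Q_{R_{\mathfrak{m}}}$. Via this bijection $\mathbb{Z}^{\mathfrak{V}_R}$ is identified with $\prod_{\mathfrak{m}\in\operatorname{Max}(R)}\mathbb{Z}^{\mathfrak{V}_{R_{\mathfrak{m}}}}$.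 *)

(* Defs.v *)
From HB Require Import structures.
From mathcomp Require Import all_boot all_order all_algebra.
From mathcomp Require Import generic_quotient ring.
From mathcomp Require Import boolp classical_sets functions cardinality.

Set Implicit Arguments.
Unset Strict Implicit.
Unset Printing Implicit Defensive.

Import GRing.Theory.
Local Open Scope classical_set_scope.
Local Open Scope ring_scope.
Local Open Scope quotient_scope.

(* Rings are [comPzRingType]s, i.e. commutative unitary rings which may be
   zero: the localization at any multiplicative subset is then again such a
   ring. Subsets, ideals and subrings are classical sets. *)

Module Loc.
Section Construction.
Variables (R : comPzRingType) (S : mulrClosed R).

Definition denom := {s : R | s \in S}.
Definition frac := (R * denom)%type.

Definition equiv (x y : frac) : bool :=
  `[< exists2 u, u \in S & u * (x.1 * sval y.2) = u * (y.1 * sval x.2) >].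

Lemma equiv_refl : reflexive equiv.
Proof. by move=> x; apply/asboolP; exists 1; rewrite ?rpred1. Qed.

Lemma equiv_sym : symmetric equiv.
Proof. by move=> x y; apply/asboolP/asboolP => -[u uS e]; exists u. Qed.

Lemma equiv_trans : transitive equiv.
Proof.
move=> [b t] [a s] [c r] /asboolP[u uS /= xy] /asboolP[v vS /= yz].
apply/asboolP; exists (u * v * sval t) => /=.
  by rewrite !rpredM // (valP t).
transitivity (v * sval r * (u * (a * sval t))); first by ring.
rewrite xy; transitivity (u * sval s * (v * (b * sval r))); first by ring.
by rewrite yz; ring.
Qed.

Canonical equiv_equiv := EquivRel equiv equiv_refl equiv_sym equiv_trans.

Definition type := {eq_quot equiv}.
HB.instance Definition _ : EqQuotient _ equiv type := EqQuotient.on type.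
HB.instance Definition _ := Choice.on type.

Definition one_denom : denom := exist _ 1 (rpred1 S).
Definition mul_denom (s t : denom) : denom :=
  exist _ (sval s * sval t) (rpredM (valP s) (valP t)).

Definition mk (a : R) (s : denom) : type := \pi_type (a, s).

Lemma eq_mk a s b t :
  mk a s = mk b t <-> exists2 u, u \in S & u * (a * sval t) = u * (b * sval s).
Proof.
split=> [/eqmodP/asboolP //|e]; apply/eqmodP; exact/asboolP.
Qed.

Lemma mk_repr (c : type) : c = mk (repr c).1 (repr c).2.
Proof. by rewrite /mk -surjective_pairing reprK. Qed.

Lemma mkP (c : type) : exists a s, c = mk a s.
Proof. by exists (repr c).1, (repr c).2; exact: mk_repr. Qed.

Definition zero : type := mk 0 one_denom.
Definition one : type := mk 1 one_denom.
Definition add (c d : type) : type :=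
  mk ((repr c).1 * sval (repr d).2 + (repr d).1 * sval (repr c).2)
     (mul_denom (repr c).2 (repr d).2).
Definition opp (c : type) : type := mk (- (repr c).1) (repr c).2.
Definition mul (c d : type) : type :=
  mk ((repr c).1 * (repr d).1) (mul_denom (repr c).2 (repr d).2).

Lemma repr_mk a s : exists2 u, u \in S &
  u * ((repr (mk a s)).1 * sval s) = u * (a * sval (repr (mk a s)).2).
Proof. by apply/eq_mk; rewrite -mk_repr. Qed.

Lemma add_mk a s b t :
  add (mk a s) (mk b t) = mk (a * sval t + b * sval s) (mul_denom s t).
Proof.
have [u uS eu] := repr_mk a s; have [v vS ev] := repr_mk b t.
rewrite /add; move: (repr (mk a s)) (repr (mk b t)) eu ev => [a' s'] [b' t'] /= eu ev.
apply/eq_mk; exists (u * v); rewrite ?rpredM //=.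
transitivity (v * sval t' * sval t * (u * (a' * sval s)) +
              u * sval s' * sval s * (v * (b' * sval t))); first by ring.
by rewrite eu ev; ring.
Qed.

Lemma opp_mk a s : opp (mk a s) = mk (- a) s.
Proof.
have [u uS eu] := repr_mk a s; apply/eq_mk; exists u => //.
by rewrite !mulNr !mulrN eu.
Qed.

Lemma mul_mk a s b t : mul (mk a s) (mk b t) = mk (a * b) (mul_denom s t).
Proof.
have [u uS eu] := repr_mk a s; have [v vS ev] := repr_mk b t.
rewrite /mul; move: (repr (mk a s)) (repr (mk b t)) eu ev => [a' s'] [b' t'] /= eu ev.
apply/eq_mk; exists (u * v); rewrite ?rpredM //=.
transitivity ((u * (a' * sval s)) * (v * (b' * sval t))); first by ring.
by rewrite eu ev; ring.
Qed.

Lemma eq_mk1 a s b t : a * sval t = b * sval s -> mk a s = mk b t.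
Proof. by move=> e; apply/eq_mk; exists 1; rewrite ?rpred1 // e. Qed.

Lemma addA : associative add.
Proof.
move=> x y z.
have [[a [s ->]] [b [t ->]] [c [r ->]]] := And3 (mkP x) (mkP y) (mkP z).
by rewrite !add_mk; apply: eq_mk1 => /=; ring.
Qed.

Lemma addC : commutative add.
Proof.
move=> x y; have [[a [s ->]] [b [t ->]]] := conj (mkP x) (mkP y).
by rewrite !add_mk; apply: eq_mk1 => /=; ring.
Qed.

Lemma add0 : left_id zero add.
Proof.
move=> x; have [a [s ->]] := mkP x.
by rewrite add_mk; apply: eq_mk1 => /=; ring.
Qed.

Lemma addN : left_inverse zero opp add.
Proof.
move=> x; have [a [s ->]] := mkP x.
by rewrite opp_mk add_mk; apply: eq_mk1 => /=; ring.
Qed.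

HB.instance Definition _ := GRing.isZmodule.Build type addA addC add0 addN.

Lemma mulA : associative mul.
Proof.
move=> x y z.
have [[a [s ->]] [b [t ->]] [c [r ->]]] := And3 (mkP x) (mkP y) (mkP z).
by rewrite !mul_mk; apply: eq_mk1 => /=; ring.
Qed.

Lemma mulC : commutative mul.
Proof.
move=> x y; have [[a [s ->]] [b [t ->]]] := conj (mkP x) (mkP y).
by rewrite !mul_mk; apply: eq_mk1 => /=; ring.
Qed.

Lemma mul1 : left_id one mul.
Proof.
move=> x; have [a [s ->]] := mkP x.
by rewrite mul_mk; apply: eq_mk1 => /=; ring.
Qed.

Lemma mulD : left_distributive mul add.
Proof.
move=> x y z.
have [[a [s ->]] [b [t ->]] [c [r ->]]] := And3 (mkP x) (mkP y) (mkP z).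
by rewrite !(mul_mk, add_mk); apply: eq_mk1 => /=; ring.
Qed.

HB.instance Definition _ :=
  GRing.Zmodule_isComPzRing.Build type mulA mulC mul1 mulD.

Definition emb (a : R) : type := mk a one_denom.

Lemma emb_is_zmod_morphism : zmod_morphism emb.
Proof.
move=> a b; rewrite -[RHS]/(add (emb a) (opp (emb b))) opp_mk add_mk.
by apply: eq_mk1 => /=; ring.
Qed.
HB.instance Definition _ :=
  GRing.isZmodMorphism.Build R type emb emb_is_zmod_morphism.

Lemma emb_is_monoid_morphism : monoid_morphism emb.
Proof.
split=> // a b; rewrite -[RHS]/(mul (emb a) (emb b)) mul_mk.
by apply: eq_mk1 => /=; ring.
Qed.
HB.instance Definition _ :=
  GRing.isMonoidMorphism.Build R type emb emb_is_monoid_morphism.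

End Construction.

Section Functoriality.
Variables (A B : comPzRingType) (S : mulrClosed A) (T : mulrClosed B).
Variables (f : {rmorphism A -> B}) (fST : forall s, s \in S -> f s \in T).

Definition map_denom (s : denom S) : denom T :=
  exist _ (f (sval s)) (fST (valP s)).

Definition map (c : type S) : type T :=
  mk (f (repr c).1) (map_denom (repr c).2).

Lemma map_mk a s : map (mk a s) = mk (f a) (map_denom s).
Proof.
have [u uS eu] := repr_mk a s; apply/eq_mk; exists (f u); first exact: fST.
by rewrite /= -!rmorphM eu.
Qed.

Lemma map_is_zmod_morphism : zmod_morphism map.
Proof.
move=> x y; have [[a [s ->]] [b [t ->]]] := conj (mkP x) (mkP y).
rewrite -[_ - _]/(add (mk a s) (opp (mk b t))) opp_mk add_mk !map_mk.
rewrite -[RHS]/(add (mk _ _) (opp (mk _ _))) opp_mk add_mk.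
by apply: eq_mk1 => /=; rewrite !(rmorphD, rmorphM, rmorphN).
Qed.
HB.instance Definition _ :=
  GRing.isZmodMorphism.Build (type S) (type T) map map_is_zmod_morphism.

Lemma map_is_monoid_morphism : monoid_morphism map.
Proof.
split=> [|x y].
  by rewrite -[X in map X]/(mk 1 _) map_mk; apply: eq_mk1; rewrite /= !rmorph1.
have [[a [s ->]] [b [t ->]]] := conj (mkP x) (mkP y).
rewrite -[_ * _]/(mul (mk a s) (mk b t)) mul_mk !map_mk.
rewrite -[RHS]/(mul (mk _ _) (mk _ _)) mul_mk.
by apply: eq_mk1 => /=; rewrite !rmorphM.
Qed.
HB.instance Definition _ :=
  GRing.isMonoidMorphism.Build (type S) (type T) map map_is_monoid_morphism.

End Functoriality.
End Loc.
HB.export Loc.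

Section Ideals.
Variable A : comPzRingType.
Implicit Types (V I M P : set A).

(* [V] is meant to be a subring of [A], so that ideals of [A] itself are the
   case [V = setT]. *)
Definition is_ideal V I : Prop :=
  [/\ I `<=` V, I 0, forall x y, I x -> I y -> I (x + y)
    & forall a x, V a -> I x -> I (a * x)].

Definition is_maximal V M : Prop :=
  [/\ is_ideal V M, M <> V
    & forall I, is_ideal V I -> M `<=` I -> I = M \/ I = V].

Definition Max : set (set A) := [set M | is_maximal setT M].

Definition is_prime P : Prop :=
  [/\ is_ideal setT P, P <> setT & forall x y, P (x * y) -> P x \/ P y].

Definition span (s : seq A) : set A :=
  [set x | exists c : 'I_(size s) -> A, x = \sum_(i < size s) c i * s`_i].

Definition noetherian : Prop :=
  forall I, is_ideal setT I -> exists s : seq A, I = span s.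

Definition prime_chain n (P : 'I_n.+1 -> set A) : Prop :=
  (forall i, is_prime (P i)) /\ forall i j : 'I_n.+1, (i < j)%N -> P i `<` P j.

Definition has_krull_dim n : Prop :=
  (exists P : 'I_n.+1 -> set A, prime_chain P) /\
  forall k (P : 'I_k.+1 -> set A), prime_chain P -> (k <= n)%N.

Definition reduced : Prop := forall (x : A) n, x ^+ n = 0 -> x = 0.

Definition semilocal : Prop := finite_set Max.

Definition regular_sequence (s : seq A) : Prop :=
  (forall i, (i < size s)%N ->
     forall a, span (take i s) (s`_i * a) -> span (take i s) a)
  /\ span s <> setT.

Definition has_grade I n : Prop :=
  (exists s : seq A,
     [/\ size s = n, forall x, x \in s -> I x & regular_sequence s]) /\
  forall s : seq A, (forall x, x \in s -> I x) -> regular_sequence s ->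
    (size s <= n)%N.

(* The depth of a local ring is the grade of its unique maximal ideal. *)
Definition has_local_depth n : Prop :=
  exists2 M, Max = [set M] & has_grade M n.

End Ideals.
Arguments Max : clear implicits.
Arguments noetherian : clear implicits.
Arguments has_krull_dim : clear implicits.
Arguments reduced : clear implicits.
Arguments semilocal : clear implicits.
Arguments has_local_depth : clear implicits.

Section RegularElements.
Variable A : comPzRingType.

Definition regular : {pred A} := [pred x | `[< GRing.lreg x >]].

Lemma regular_mulr_closed : mulr_closed regular.
Proof.
split=> [|x y /asboolP rx /asboolP ry]; apply/asboolP; first exact: lreg1.
exact: lregM.
Qed.
HB.instance Definition _ :=
  GRing.isMulClosed.Build A regular regular_mulr_closed.

(* T^reg, for a subset T *)
Definition regpart (T : set A) : set A := T `&` [set x | x \in regular].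

End RegularElements.
Arguments regular : clear implicits.

Section Localization.
Variable R : comPzRingType.

Definition away (m : Max R) : {pred R} := [pred x | x \notin val m].

Lemma away_mulr_closed m : mulr_closed (away m).
Proof.
have /set_mem[[_ m0 mD mM] mT mmax] := valP m.
split=> [|x y]; rewrite !inE.
  apply/negP => /set_mem m1; apply: mT; apply/seteqP; split=> // x _.
  by rewrite -[x]mulr1; apply: mM.
move=> /negP nx /negP ny; apply/negP => /set_mem mxy; apply: ny; apply/mem_set.
pose I := [set z | exists2 p : R * R, val m p.1 & z = p.1 + p.2 * x].
have I_ideal : is_ideal setT I.
  split=> //; first by exists (0, 0) => //=; rewrite mul0r addr0.
    move=> _ _ [[p a] /= mp ->] [[q b] /= mq ->].
    by exists (p + q, a + b); [exact: mD | rewrite /=; ring].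
  move=> a _ _ [[p b] /= mp ->].
  by exists (a * p, a * b); [exact: mM | rewrite /=; ring].
have mI : val m `<=` I by move=> z mz; exists (z, 0) => //=; rewrite mul0r addr0.
have Ix : I x by exists (0, 1) => //=; rewrite mul1r add0r.
have [eIm|IT] := mmax I I_ideal mI.
  by case: nx; apply/mem_set; rewrite -eIm.
have [[p a] /= mp e1] : I 1 by rewrite IT.
rewrite -[y]mul1r e1 mulrDl; apply: mD; first by rewrite mulrC; apply: mM.
by rewrite -mulrA; apply: mM.
Qed.
HB.instance Definition _ m :=
  GRing.isMulClosed.Build R (away m) (away_mulr_closed m).

Definition locmax (m : Max R) : comPzRingType := Loc.type (away m).

Definition to_locmax (m : Max R) : {rmorphism R -> locmax m} :=
  @Loc.emb R (away m).

End Localization.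

(* Total ring of fractions *)
Definition Qr (R : comPzRingType) : comPzRingType := Loc.type (regular R).

(* R as a subring of its total ring of fractions *)
Definition base (R : comPzRingType) : set (Qr R) :=
  range (@Loc.emb R (regular R)).
Arguments base : clear implicits.

Lemma to_locmax_regular (R : comPzRingType) (m : Max R) (s : R) :
  s \in regular R -> to_locmax m s \in regular (locmax m).
Proof.
move=> /asboolP rs; apply/asboolP => x y.
have [[a [t ->]] [b [r ->]]] := conj (Loc.mkP x) (Loc.mkP y).
rewrite -[X in X = _]/(Loc.mul (Loc.mk s _) (Loc.mk a t)).
rewrite -[X in _ = X]/(Loc.mul (Loc.mk s _) (Loc.mk b r)) !Loc.mul_mk.
move=> /Loc.eq_mk[u uS /= e]; apply/Loc.eq_mk; exists u => //; apply: rs.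
by transitivity (u * (s * a * (1 * sval r))); [ring | rewrite e; ring].
Qed.

(* The canonical map Q_R -> Q_{R_m}, sending a/b to (a/1)/(b/1) *)
Definition Q_to_locmax (R : comPzRingType) (m : Max R) :
    {rmorphism Qr R -> Qr (locmax m)} :=
  Loc.map (f := to_locmax m) (@to_locmax_regular R m).

Section ValueSemigroups.
Variable R : comPzRingType.
Local Notation Q := (Qr R).
Implicit Types (E F V M : set Q) (x : Q).

Definition fractional_ideal E : Prop :=
  [/\ E 0, forall x y, E x -> E y -> E (x + y),
      forall r x, base R r -> E x -> E (r * x)
    & exists2 r, regpart (base R) r & forall x, E x -> base R (r * x)].

Definition regular_fractional_ideal E : Prop :=
  fractional_ideal E /\ regpart E !=set0.

Definition valuation_rings : set (set Q) :=
  [set V : set Q | [/\ GRing.subring_closed [in V], base R `<=` V, V `<` setT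
             & forall x y, ~ V x -> ~ V y -> ~ V (x * y)]].

(* The product of two modules: finite sums of products *)
Definition mulset E F : set Q :=
  [set z | exists n (x y : 'I_n -> Q),
     [/\ forall i, E (x i), forall i, F (y i) & z = \sum_(i < n) x i * y i]].

Definition colon E F : set Q := [set x | forall y, F y -> E (x * y)].

(* m_V: the default value [set0] is irrelevant, since every V in
   [valuation_rings] has exactly one regular maximal ideal when R is
   one-dimensional semilocal Cohen-Macaulay. *)
Definition regmax V : set Q :=
  xget set0 [set M | is_maximal V M /\ regpart M !=set0].

(* m_V^k as a fractional ideal of V; the inverse of the invertible ideal m_V
   is V : m_V. *)
Definition regmax_exp V (k : int) : set Q :=
  match k with
  | Posz n => iter n (mulset (regmax V)) V
  | Negz n => iter n.+1 (mulset (colon V (regmax V))) V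
  end.

(* nu_V, where [None] stands for the value infinity *)
Definition nu V x : option int :=
  if `[< forall k, regmax_exp V k x >] then None
  else Some (xget 0 [set k | regmax_exp V k x /\
                            forall j, regmax_exp V j x -> (j <= k)%R]).

(* Gamma_E, as a subset of Z^(valuation_rings) *)
Definition Gamma E : set (valuation_rings -> int) :=
  [set g | exists2 x, regpart E x
         & forall V : valuation_rings, nu (val V) x = Some (g V)].

Definition local_semigroup (G : set (valuation_rings -> int)) : Prop :=
  [set g | G g /\ exists V : valuation_rings, g V = 0] = [set cst 0].

End ValueSemigroups.
Arguments valuation_rings : clear implicits.

Section Decomposition.
Variable R : comPzRingType.

Definition one_dim_cohen_macaulay : Prop :=
  [/\ noetherian R, has_krull_dim R 1
    & forall m : Max R, has_local_depth (locmax m) 1].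

(* E_m = E R_m, inside Q_{R_m} *)
Definition locideal (m : Max R) (E : set (Qr R)) : set (Qr (locmax m)) :=
  mulset (Q_to_locmax m @` E) (base (locmax m)).

(* [beta] is the bijection from the disjoint union of the sets of valuation
   rings of the R_m to the set of valuation rings of R which takes the
   preimage under Q_R -> Q_{R_m}. *)
Definition valuation_rings_bijection
    (beta : forall m : Max R, valuation_rings (locmax m) -> valuation_rings R)
    : Prop :=
  bijective (fun w : {m : Max R & valuation_rings (locmax m)} =>
               beta (tag w) (tagged w)) /\
  forall m W, val (beta m W) = Q_to_locmax m @^-1` (val W).

(* The product of the [G m], as a subset of Z^(valuation_rings R) *)
Definition prod_semigroup
    (beta : forall m : Max R, valuation_rings (locmax m) -> valuation_rings R)
    (G : forall m : Max R, set (valuation_rings (locmax m) -> int))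
    : set (valuation_rings R -> int) :=
  [set g : valuation_rings R -> int | forall m, G m (g \o beta m)].

End Decomposition.
Arguments one_dim_cohen_macaulay : clear implicits.
Arguments locideal {R} m E.

(* Main.v *)
(* Since [R] is reduced and Noetherian, [Q_R] is von Neumann regular, and the
   maps [phi_m : Q_R -> Q_{R_m}] are surjective. Idempotents of [Q_R] belong to
   every valuation ring [V], which makes its regular maximal ideal [m_V] unique
   and shows that [V] contains the kernel of [phi_m] for [m = m_V :&: R]. Hence
   [V] is the preimage of [phi_m V], and the powers of [m_V] are the preimages
   of those of the maximal ideal of [phi_m V], so that the values agree.

   Given elements [e_m] of [E] invertible in [Q_{R_m}], the ideal of all [a]
   with [a E_n] contained in [n e_n R_n] contains a regular element and is
   saturated at [n], hence lies in no maximal ideal other than [n], because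
   [dim R = 1]. This gives [a_m] outside [m] multiplying [E] into [n e_n R_n]
   for all [n <> m], and [x = \sum_m a_m e_m] satisfies [phi_m x = u e_m] with
   a unit [u] of [R_m]. *)

From mathcomp Require Import all_boot all_order all_algebra.
From mathcomp Require Import ring.
From mathcomp Require Import boolp classical_sets functions cardinality.
Require Import Defs.

Set Implicit Arguments.
Unset Strict Implicit.
Unset Printing Implicit Defensive.

Import GRing.Theory.
Local Open Scope classical_set_scope.
Local Open Scope ring_scope.

(** * Maximal and prime ideals *)

Definition is_subring (A : comPzRingType) (V : set A) : Prop :=
  [/\ V 1, forall x y, V x -> V y -> V (x - y)
    & forall x y, V x -> V y -> V (x * y)].

Definition invertible (A : comPzRingType) (x : A) : Prop :=
  exists y, x * y = 1.

Section Units.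
Variable A : comPzRingType.
Implicit Types x y : A.

Lemma invertible_regular x : invertible x -> x \in regular A.
Proof.
move=> [y xy]; apply/asboolP => a b /(congr1 ( *%R y)).
by rewrite !mulrA ![y * x]mulrC xy !mul1r.
Qed.

Lemma invertibleM x y : invertible x -> invertible y -> invertible (x * y).
Proof.
move=> [x' xx'] [y' yy']; exists (x' * y').
by rewrite mulrACA xx' yy' mulr1.
Qed.

Lemma invertible_mull x y : invertible (x * y) -> invertible x.
Proof. by move=> [z xyz]; exists (y * z); rewrite mulrA. Qed.

Lemma invertible_rmorph (B : comPzRingType) (f : {rmorphism A -> B}) x :
  invertible x -> invertible (f x).
Proof. by move=> [y xy]; exists (f y); rewrite -rmorphM xy rmorph1. Qed.

Lemma regular_eq0 x y : x \in regular A -> x * y = 0 -> y = 0.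
Proof. by move=> /asboolP rx xy0; apply: rx; rewrite xy0 mulr0. Qed.

Lemma regular_mulr x y : x * y \in regular A -> x \in regular A.
Proof.
move=> /asboolP rxy; apply/asboolP => a b e; apply: rxy.
by rewrite ![x * y]mulrC -!mulrA e.
Qed.

Lemma regular_of_mul_eq0 x :
  (forall y, x * y = 0 -> y = 0) -> x \in regular A.
Proof.
move=> rx; apply/asboolP => a b e; apply/eqP; rewrite -subr_eq0; apply/eqP.
by apply: rx; rewrite mulrBr e subrr.
Qed.

End Units.

(** * Ideals of a subring and Zorn's lemma *)

Section Subrings.
Variables (A : comPzRingType) (V : set A).
Hypothesis Vring : is_subring V.

Lemma subring0 : V 0.
Proof. by have [V1 VB _] := Vring; rewrite -(subrr 1); apply: VB. Qed.

Lemma subringN x : V x -> V (- x).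
Proof.
move=> Vx; have [_ VB _] := Vring; rewrite -sub0r.
by apply: VB => //; exact: subring0.
Qed.

Lemma subringD x y : V x -> V y -> V (x + y).
Proof.
move=> Vx Vy; have [_ VB _] := Vring; rewrite -[y]opprK.
by apply: VB => //; apply: subringN.
Qed.

Lemma ideal_eq_ring I : is_ideal V I -> I 1 -> I = V.
Proof.
move=> [IV _ _ IM] I1; apply/seteqP; split=> // x Vx.
by rewrite -[x]mulr1; apply: IM.
Qed.

Lemma idealN I x : is_ideal V I -> I x -> I (- x).
Proof.
move=> [_ _ _ IM] Ix; rewrite -mulN1r; apply: IM => //; apply: subringN.
by have [] := Vring.
Qed.

Definition adjoin (I : set A) (x : A) : set A :=
  [set z | exists2 p : A * A, I p.1 /\ V p.2 & z = p.1 + p.2 * x].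

Lemma adjoin_ideal I x : is_ideal V I -> V x -> is_ideal V (adjoin I x).
Proof.
have [V1 VB VM] := Vring; move=> [IV I0 ID IM] Vx; split.
- move=> _ [[p a] /= [Ip Va] ->].
  by apply: subringD; [exact: IV | exact: VM].
- by exists (0, 0); rewrite /= ?mul0r ?addr0 //; split=> //; exact: subring0.
- move=> _ _ [[p a] /= [Ip Va] ->] [[q b] /= [Iq Vb] ->].
  exists (p + q, a + b) => /=; last by ring.
  by split; [exact: ID | exact: subringD].
- move=> a _ Va [[q b] /= [Iq Vb] ->].
  exists (a * q, a * b) => /=; last by ring.
  by split; [exact: IM | exact: VM].
Qed.

Lemma sub_adjoin I x : I `<=` adjoin I x.
Proof.
move=> z Iz; exists (z, 0); rewrite /= ?mul0r ?addr0 //.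
by split=> //; exact: subring0.
Qed.

Lemma mem_adjoin I x : is_ideal V I -> adjoin I x x.
Proof.
have [V1 _ _] := Vring; move=> [_ I0 _ _].
by exists (0, 1); rewrite /= ?mul1r ?add0r.
Qed.

Lemma exists_maximal_avoiding (J S : set A) :
  is_ideal V J -> (forall x, J x -> ~ S x) ->
  exists M, [/\ is_ideal V M, J `<=` M, forall x, M x -> ~ S x
    & forall I, is_ideal V I -> M `<=` I -> (forall x, I x -> ~ S x) -> I = M].
Proof.
move=> JI JS; have [JV J0 JD JM] := JI.
(* [Zorn_bigcup] also asks for the union of the empty chain, which is the empty set; describing an
   ideal as the union of [J] and [X] makes that case the ideal [J] itself. *)
pose P := [set X | is_ideal V (J `|` X) /\ forall x, (J `|` X) x -> ~ S x].
have [F FP Ftot|M [[MI MS] Mmax]] := @Zorn_bigcup _ P.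
  have memF X x : F X -> (J `|` X) x -> (J `|` \bigcup_(X in F) X) x.
    by move=> FX [Jx|Xx]; [left | right; exists X].
  split; last first.
    by move=> x [/JS//|[X FX Xx]]; apply: (FP _ FX).2; right.
  split.
  - move=> x [/JV//|[X FX Xx]].
    by have [[XV _ _ _] _] := FP _ FX; apply: XV; right.
  - by left.
  - have key X x y : F X -> (J `|` X) x -> (J `|` X) y ->
        (J `|` \bigcup_(X in F) X) (x + y).
      move=> FX Xx Xy; apply: (memF X) => //.
      by have [[_ _ XD _] _] := FP _ FX; apply: XD.
    move=> x y [Jx|[X FX Xx]] [Jy|[Y FY Yy]].
    + by left; exact: JD.
    + by apply: (key Y) => //; [left | right].
    + by apply: (key X) => //; [right | left].
    + have [XY|YX] := Ftot X Y FX FY.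
        by apply: (key Y) => //; right => //; exact: XY.
      by apply: (key X) => //; right => //; exact: YX.
  - move=> a x Va [Jx|[X FX Xx]]; first by left; exact: JM.
    apply: (memF X) => //; have [[_ _ _ XM] _] := FP _ FX.
    by apply: XM => //; right.
exists (J `|` M); split=> // I II JMI IS; apply/seteqP; split=> // x Ix.
have eJI : J `|` I = I.
  by apply/setUidPr; apply: subset_trans JMI; exact: subsetUl.
apply: contrapT => nx; apply: (Mmax I); last by split; rewrite eJI.
split; first by apply: subset_trans JMI; exact: subsetUr.
by move=> IM; apply: nx; right; exact: IM.
Qed.

(** If neither factor lay in [M], adjoining either one would produce an element of [S]. The product
    of these two elements lies in [S], yet it expands into multiples of elements of [M] and of
    [x * y]. *)
Lemma maximal_avoiding_prime (M S : set A) :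
  is_ideal V M -> (forall x, M x -> ~ S x) ->
  (forall x y, S x -> S y -> S (x * y)) ->
  (forall I, is_ideal V I -> M `<=` I -> (forall x, I x -> ~ S x) -> I = M) ->
  forall x y, V x -> V y -> M (x * y) -> M x \/ M y.
Proof.
move=> MI MS Smul Mmax x y Vx Vy Mxy; have [MV M0 MD MM] := MI.
have meet z : V z -> ~ M z -> exists2 s, adjoin M z s & S s.
  move=> Vz nMz; apply: contrapT => ns; apply: nMz.
  rewrite -(Mmax (adjoin M z)).
  - exact: mem_adjoin.
  - exact: adjoin_ideal.
  - exact: sub_adjoin.
  - by move=> s As Ss; apply: ns; exists s.
have [|nMx] := pselect (M x); [by left | right].
apply: contrapT => nMy.
have [_ [[p a] /= [Mp Va] ->] Ss] := meet x Vx nMx.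
have [_ [[q b] /= [Mq Vb] ->] St] := meet y Vy nMy.
have [_ _ VM] := Vring.
apply: (MS _ _ (Smul _ _ Ss St)).
have -> : (p + a * x) * (q + b * y) =
    (q + b * y) * p + (a * x) * q + (a * b) * (x * y) by ring.
apply: (MD); first apply: (MD); apply: MM => //.
- by apply: subringD; [exact: MV | exact: VM].
- exact: VM.
- exact: VM.
Qed.

(** Maximal ideals are the case [S = [set 1]] of ideals maximal among those avoiding [S], which puts
    them within reach of the two preceding lemmas. *)
Lemma maximal_avoiding1 M :
  is_maximal V M <-> [/\ is_ideal V M, ~ M 1
    & forall I, is_ideal V I -> M `<=` I -> ~ I 1 -> I = M].
Proof.
have [V1 _ _] := Vring; split=> [[MI MV Mmax]|[MI M1 Mmax]]; split=> //.
- by move=> M1; apply: MV; exact: ideal_eq_ring.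
- by move=> I II MI' I1; have [//|IV] := Mmax I II MI'; case: I1; rewrite IV.
- by move=> MV; apply: M1; rewrite MV.
- move=> I II sMI; have [I1|nI1] := pselect (I 1).
    by right; exact: ideal_eq_ring.
  by left; exact: Mmax.
Qed.

Lemma exists_maximal_above J : is_ideal V J -> ~ J 1 ->
  exists2 M, is_maximal V M & J `<=` M.
Proof.
move=> JI J1.
have [|M [MI JM M1 Mmax]] := @exists_maximal_avoiding J [set 1] JI.
  by move=> x Jx x1; apply: J1; rewrite -x1.
exists M => //; apply/maximal_avoiding1; split=> //.
  by move=> /M1; apply.
by move=> I II MI' I1; apply: Mmax => // x Ix x1; apply: I1; rewrite -x1.
Qed.

Lemma maximal_prime M : is_maximal V M ->
  forall x y, V x -> V y -> M (x * y) -> M x \/ M y.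
Proof.
move=> /maximal_avoiding1[MI M1 Mmax].
apply: (@maximal_avoiding_prime M [set 1]) => //.
- by move=> x Mx x1; apply: M1; rewrite -x1.
- by move=> x y /= -> ->; rewrite mulr1.
- by move=> I II MI' I1; apply: Mmax => // I1'; apply: (I1 1).
Qed.

End Subrings.

Lemma setT_subring (A : comPzRingType) : is_subring [set: A].
Proof. by []. Qed.
#[local] Hint Resolve setT_subring : core.

(** * Prime ideals in dimension one *)

Section Primes.
Variable A : comPzRingType.
Implicit Types (I J P M S : set A).

Lemma exists_prime_avoiding J S : is_ideal setT J -> S 1 ->
  (forall x y, S x -> S y -> S (x * y)) -> (forall x, J x -> ~ S x) ->
  exists P, [/\ is_prime P, J `<=` P & forall x, P x -> ~ S x].
Proof.
move=> JI S1 Smul JS.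
have [P [PI JP PS Pmax]] := exists_maximal_avoiding JI JS.
exists P; split=> //; split=> //.
  by move=> PT; apply: (PS 1) => //; rewrite PT.
by move=> x y; apply: (maximal_avoiding_prime _ PI PS Smul Pmax).
Qed.

Lemma prime1 P : is_prime P -> ~ P 1.
Proof. by move=> [PI PT _] P1; apply: PT; exact: ideal_eq_ring. Qed.

Lemma maximal_is_prime M : Max A M -> is_prime M.
Proof.
move=> Mmax; have [MI MT _] := Mmax; split=> // x y.
exact: (maximal_prime _ Mmax).
Qed.

(* A prime strictly between a minimal one and a maximal one does not exist, and
   a minimal prime consists of zero divisors. *)
Lemma regular_prime_maximal P c : has_krull_dim A 1 -> is_prime P -> P c ->
  c \in regular A -> Max A P.
Proof.
move=> [_ dimA] Pprime Pc rc; have [PI PT Pmul] := Pprime.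
have P1 := prime1 Pprime.
have [M Mmax PM] := exists_maximal_above (setT_subring A) PI P1.
have [->//|neqPM] := pselect (P = M).
(* A prime avoiding [S] lies in [P], by the exponent 0, and omits [c], by the factor 1, so it lies
   strictly below [P]. Regularity of [c] keeps 0 out of [S]. *)
pose S := [set x | exists2 p : nat * A, ~ P p.2 & x = c ^+ p.1 * p.2].
have zero_ideal : is_ideal setT [set (0 : A)].
  split=> //= [x y -> ->|a x _ ->]; first by rewrite addr0.
  by rewrite mulr0.
have [||x0 /= x00 [[k s] /= Ps]|P0 [P0prime _ P0S]] :=
    @exists_prime_avoiding [set 0] S zero_ideal.
- by exists (0%N, 1); rewrite //= mulr1.
- move=> _ _ [[k s] /= Ps ->] [[l t] /= Pt ->].
  exists ((k + l)%N, s * t) => /=; last by rewrite exprD; ring.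
  by move=> /Pmul[].
- rewrite x00 => /esym e; apply: Ps.
  suff -> : s = 0 by have [] := PI.
  apply: regular_eq0 e; elim: k => [|k IH]; first by rewrite expr0 rpred1.
  by rewrite exprS rpredM.
have P0P : P0 `<=` P.
  move=> x P0x; apply: contrapT => nPx; apply: (P0S x) => //.
  by exists (0%N, x); rewrite //= mul1r.
have nP0c : ~ P0 c.
  by move=> /P0S; apply; exists (1%N, 1); rewrite //= mulr1.
have ltP0P : P0 `<` P by split=> // PP0; apply: nP0c; exact: PP0.
have ltPM : P `<` M.
  by split=> // MP; apply: neqPM; apply/seteqP.
pose ch (i : 'I_3) := nth setT [:: P0; P; M] i.
suff: (2 <= 1)%N by [].
apply: (dimA 2 ch); split.
  by move=> [[|[|[|i]]] Hi] //=; rewrite /ch /=; exact: maximal_is_prime.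
move=> [[|[|[|i]]] Hi] [[|[|[|j]]] Hj] //= _; rewrite /ch //=.
by split=> [x /P0P/PM//|MP0]; apply: nP0c; apply: MP0; exact: PM.
Qed.

(* Every prime over [J] is maximal, so the localization of [J] at [n] is
   [n]-primary. *)
Lemma power_in_regular_ideal J n c t : has_krull_dim A 1 ->
  is_ideal setT J -> J c -> c \in regular A -> Max A n -> n t ->
  exists k s, ~ n s /\ J (s * t ^+ k).
Proof.
move=> dimA JI Jc rc nmax nt; apply: contrapT => nex.
have nprime := maximal_is_prime nmax; have n1 := prime1 nprime.
(* A prime over [J] avoiding [S] is maximal and, by the exponent 0, lies in [n], so it equals [n];
   yet it omits [t]. *)
pose S := [set x | exists2 p : nat * A, ~ n p.2 & x = p.2 * t ^+ p.1].
have [||x Jx [[k s] /= ns e]|P [Pprime JP PS]] :=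
    @exists_prime_avoiding J S JI.
- by exists (0%N, 1); rewrite //= mulr1.
- move=> _ _ [[k s] /= ns ->] [[l r] /= nr ->].
  exists ((k + l)%N, s * r) => /=; last by rewrite exprD; ring.
  by have [_ _ nmul] := nprime; move=> /nmul[].
- by apply: nex; exists k, s; rewrite -e.
have [_ PT Pmax] := regular_prime_maximal dimA Pprime (JP _ Jc) rc.
have Pn : P `<=` n.
  move=> x Px; apply: contrapT => nx; apply: (PS x) => //.
  by exists (0%N, x); rewrite //= mulr1.
have [nI nT _] := nmax.
have [enP|//] := Pmax n nI Pn.
by apply: (PS t); [rewrite -enP | exists (1%N, 1) => //=; rewrite mul1r].
Qed.

End Primes.

(** * Rings of fractions of reduced Noetherian rings *)

Section VonNeumannRegular.
Variable A : comPzRingType.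

Lemma span_sub (s : seq A) (I : set A) : is_ideal setT I ->
  (forall x, x \in s -> I x) -> span s `<=` I.
Proof.
move=> [_ I0 ID IM] sI _ [c ->]; apply: (big_ind I) => // i _.
by apply: IM => //; apply: sI; exact: mem_nth.
Qed.

Lemma mem_span (s : seq A) x : x \in s -> span s x.
Proof.
move=> /(nthP 0)[i lti <-]; exists (fun j => (j == Ordinal lti)%:R).
rewrite (bigD1 (Ordinal lti)) //= eqxx mul1r big1 ?addr0 // => j /negbTE ->.
by rewrite mul0r.
Qed.

(** The union of a chain that meets [F] is finitely generated, and a member containing all
    generators is the whole union. The empty set joins the family only to bound the empty chain; an
    ideal in [F] is strictly larger, so the maximal element found is in [F]. *)
Lemma noetherian_maximal (F : set (set A)) : noetherian A ->
  (forall I, F I -> is_ideal setT I) -> F !=set0 ->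
  exists I, F I /\ forall J, F J -> I `<=` J -> J = I.
Proof.
move=> noethA FI [I0 FI0].
have [C CP Ctot|M [PM Mmax]] := @Zorn_bigcup _ [set X | X = set0 \/ F X].
  have [[X0 [CX0 FX0]]|nex] := pselect (exists X, C X /\ F X); last first.
    left; rewrite bigcup0 // => X CX; have [//|FX] := CP X CX.
    by case: nex; exists X.
  right; set U := \bigcup_(X in C) X.
  have finU (s : seq A) : (forall x, x \in s -> U x) ->
      exists X, [/\ C X, F X & forall x, x \in s -> X x].
    elim: s => [_|x s IH sU]; first by exists X0.
    have [X [CX FX sX]] := IH (fun y ys => sU y (@mem_behead _ (x :: s) y ys)).
    have [Y CY Yx] := sU x (mem_head x s).
    have FY : F Y by have [e|//] := CP Y CY; move: Yx; rewrite e.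
    have [XY|YX] := Ctot X Y CX CY.
      by exists Y; split=> // y; rewrite inE => /predU1P[->//|/sX/XY].
    by exists X; split=> // y; rewrite inE => /predU1P[->|/sX//]; exact: YX.
  have UI : is_ideal setT U.
    split=> //; first by exists X0 => //; have [] := FI _ FX0.
    - move=> x y Ux Uy; have [|X [CX FX sX]] := finU [:: x; y].
        by move=> z; rewrite !inE => /orP[]/eqP ->.
      exists X => //; have [_ _ XD _] := FI _ FX.
      by apply: XD; apply: sX; rewrite !inE eqxx ?orbT.
    - move=> a x _ Ux; have [|X [CX FX sX]] := finU [:: x].
        by move=> z; rewrite !inE => /eqP ->.
      exists X => //; have [_ _ _ XM] := FI _ FX.
      by apply: XM => //; apply: sX; rewrite inE.
  have [s Us] := noethA U UI.
  have [|X [CX FX sX]] := finU s.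
    by move=> x xs; rewrite Us; exact: mem_span.
  have -> : U = X; last by [].
  apply/seteqP; split; last by move=> x Xx; exists X.
  by rewrite Us; apply: span_sub => //; exact: FI.
have FM : F M.
  case: PM => [M0|//]; case: (Mmax I0); last by right.
  have [_ I00 _ _] := FI _ FI0.
  by rewrite M0; split=> // I0s; apply: (I0s 0).
exists M; split=> // J FJ MJ; apply: contrapT => neq.
apply: (Mmax J); last by right.
by split=> // JM; apply: neq; apply/seteqP.
Qed.

Hypothesis A_reduced : reduced A.

Lemma reduced_sqr_mul_eq0 (x y : A) : x * (x * y) = 0 -> x * y = 0.
Proof.
move=> e; apply: (@A_reduced _ 2).
have -> : (x * y) ^+ 2 = y * (x * (x * y)) by ring.
by rewrite e mulr0.
Qed.

(* [z] in [ann x] is chosen with the largest double annihilator; if [x + z]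
   killed [b], then [z + b] would be a strictly better choice. *)
Lemma reduced_complement (x : A) : noetherian A ->
  exists2 z, x * z = 0 & x + z \in regular A.
Proof.
move=> noethA.
pose dann z := [set b : A | forall c, z * c = 0 -> b * c = 0].
pose F := [set I | exists2 z, x * z = 0 & I = dann z].
have [||I [[z xz0 ->] zmax]] := @noetherian_maximal F noethA.
- move=> _ [z _ ->]; split=> //= [c _|a b da db c zc|a b _ db c zc].
  + by rewrite mul0r.
  + by rewrite mulrDl da // db // addr0.
  + by rewrite -mulrA db // mulr0.
- by exists (dann 0), 0 => //; rewrite mulr0.
exists z => //; apply: regular_of_mul_eq0 => b e.
have xb0 : x * b = 0.
  apply: reduced_sqr_mul_eq0.
  have -> : x * (x * b) = x * ((x + z) * b) - (x * z) * b by ring.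
  by rewrite e xz0 mulr0 mul0r subr0.
have zb0 : z * b = 0 by move: e; rewrite mulrDl xb0 add0r.
have zbc c : (z + b) * c = 0 -> z * c = 0.
  move=> ec; apply: reduced_sqr_mul_eq0.
  have -> : z * (z * c) = z * ((z + b) * c) - (z * b) * c by ring.
  by rewrite ec zb0 mulr0 mul0r subr0.
have edann : dann (z + b) = dann z.
  apply: zmax; first by exists (z + b) => //; rewrite mulrDr xz0 xb0 addr0.
  by move=> a da c /zbc /da.
have : dann (z + b) b.
  by move=> c ec; move: (ec); rewrite mulrDl (zbc _ ec) add0r.
rewrite edann => /(_ b zb0) bb; apply: (@A_reduced _ 2); by rewrite expr2.
Qed.

End VonNeumannRegular.

Section Fractions.
Variables (A : comPzRingType) (S : mulrClosed A).
Local Notation emb := (@Loc.emb A S).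

Lemma loc_emb_eq0 a : emb a = 0 <-> exists2 u, u \in S & u * a = 0.
Proof.
split=> [/Loc.eq_mk[u uS]|[u uS ua]].
  by rewrite /= !mulr1 mulr0; exists u.
by apply/Loc.eq_mk; exists u; rewrite //= !mulr1 mulr0.
Qed.

Lemma loc_emb_invertible s : s \in S -> invertible (emb s).
Proof.
move=> sS; exists (Loc.mk 1 (exist _ s sS)).
rewrite -[LHS]/(Loc.mul (Loc.mk _ _) (Loc.mk _ _)) Loc.mul_mk.
by apply: Loc.eq_mk1; rewrite /=; ring.
Qed.

Lemma loc_fracP (x : Loc.type S) :
  exists a s, s \in S /\ emb s * x = emb a.
Proof.
have [a [[s sS] ->]] := Loc.mkP x; exists a, s; split=> //.
rewrite -[LHS]/(Loc.mul (Loc.mk _ _) (Loc.mk _ _)) Loc.mul_mk.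
by apply: Loc.eq_mk1; rewrite /=; ring.
Qed.

End Fractions.

Section TotalFractions.
Variable A : comPzRingType.
Local Notation emb := (@Loc.emb A (regular A)).

Lemma emb_inj : injective emb.
Proof.
move=> a b /eqP; rewrite -subr_eq0 -rmorphB => /eqP/loc_emb_eq0[u ru].
by move=> /(regular_eq0 ru)/eqP; rewrite subr_eq0 => /eqP.
Qed.

Lemma emb_regular_invertible a : a \in regular A -> invertible (emb a).
Proof. exact: loc_emb_invertible. Qed.

Lemma Qr_fracP (x : Qr A) : exists a b, b \in regular A /\ emb b * x = emb a.
Proof. exact: loc_fracP. Qed.

Lemma invertible_emb a : invertible (emb a) -> a \in regular A.
Proof.
move=> [y ay]; apply: regular_of_mul_eq0 => b ab; apply: emb_inj.
by rewrite rmorph0 -[LHS]mul1r -ay mulrAC -rmorphM ab rmorph0 mul0r.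
Qed.

Lemma Qr_regularP (x : Qr A) : x \in regular (Qr A) <-> invertible x.
Proof.
split; last exact: invertible_regular.
move=> rx; have [a [b [rb e]]] := Qr_fracP x.
have ra : a \in regular A.
  apply: regular_of_mul_eq0 => c ac; apply: emb_inj; rewrite rmorph0.
  apply: (regular_eq0 rx).
  apply: (regular_eq0 (invertible_regular (emb_regular_invertible rb))).
  by rewrite mulrA e -rmorphM ac rmorph0.
have [y ay] := emb_regular_invertible ra; exists (emb b * y).
by rewrite mulrA [x * _]mulrC e.
Qed.

Lemma base_subring : is_subring (base A).
Proof.
split; first by exists 1; rewrite ?rmorph1.
  by move=> _ _ [a _ <-] [b _ <-]; exists (a - b); rewrite ?rmorphB.
by move=> _ _ [a _ <-] [b _ <-]; exists (a * b); rewrite ?rmorphM.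
Qed.

(** This is von Neumann regularity of the total ring of fractions. For the numerator [a] of [x], the
    complement [z] gives [a z = 0] and an inverse [y] of [a + z]; hence [a^2 y = a], and [a y] is
    idempotent. *)
Lemma Qr_idempotent (x : Qr A) : noetherian A -> reduced A ->
  exists e y, [/\ e * e = e, x * e = x & x * y = e].
Proof.
move=> noethA redA; have [a [b [rb e]]] := Qr_fracP x.
have [z az raz] := reduced_complement redA a noethA.
have [y azy] := emb_regular_invertible raz.
have [b' bb'] := emb_regular_invertible rb.
have xE : x = emb a * b' by rewrite -e mulrAC bb' mul1r.
have az' : emb a * emb z = 0 by rewrite -rmorphM az rmorph0.
have aay : emb a * emb a * y = emb a.
  transitivity (emb a * (emb (a + z) * y) - (emb a * emb z) * y).
    by rewrite rmorphD /=; ring.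
  by rewrite azy az' mul0r subr0 mulr1.
exists (emb a * y), (emb b * y); split.
- by transitivity (emb a * emb a * y * y); [ring | rewrite aay].
- by rewrite xE; transitivity (emb a * emb a * y * b'); [ring | rewrite aay].
- by rewrite mulrA [x * _]mulrC e.
Qed.

(** The ring is the product of the parts cut out by [e] and [1 - e]: on the first, [x] is a unit
    with inverse [e * y]; on the second, [x] vanishes and [c] is a unit. *)
Lemma invertible_complement (x e y : Qr A) :
  e * e = e -> x * e = x -> x * y = e -> forall c, invertible c ->
  invertible (x + c * (1 - e)).
Proof.
move=> ee xe xy c [d cd]; exists (e * y + d * (1 - e)).
transitivity (x * e * y + x * (1 - e) * d + c * (e - e * e) * y
  + c * d * (1 - e - (e - e * e))); first by ring.
by rewrite mulrBr mulr1 xe xy ee cd !subrr; ring.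
Qed.

End TotalFractions.

(** * Valuation rings *)

Section ValuationRings.
Variable R : comPzRingType.
Local Notation Q := (Qr R).
Local Notation emb := (@Loc.emb R (regular R)).
Implicit Types (V M : set Q).

Lemma valuation_ringsP V : valuation_rings R V <->
  [/\ is_subring V, base R `<=` V, V <> setT
    & forall x y, ~ V x -> ~ V y -> ~ V (x * y)].
Proof.
split=> [[[V1 VB VM] sRV [_ VT] Vmul]|[[V1 VB VM] sRV VT Vmul]].
  split=> //; last by move=> e; apply: VT; rewrite e.
  split; first exact: set_mem V1.
    by move=> x y Vx Vy; apply: set_mem; apply: VB; exact: mem_set.
  by move=> x y Vx Vy; apply: set_mem; apply: VM; exact: mem_set.
split=> //; last first.
  by split=> // TV; apply: VT; apply/seteqP; split.
split; first exact: mem_set.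
  by move=> x y /set_mem Vx /set_mem Vy; apply: mem_set; exact: VB.
by move=> x y /set_mem Vx /set_mem Vy; apply: mem_set; exact: VM.
Qed.

Section OneValuationRing.
Variable V : set Q.
Hypothesis V_val : valuation_rings R V.

Lemma valuation_subring : is_subring V.
Proof. by have /valuation_ringsP[] := V_val. Qed.
Let Vring := valuation_subring.

Lemma valuation_base x : base R x -> V x.
Proof. by have /valuation_ringsP[_ + _ _] := V_val; apply. Qed.

Lemma valuation_inv x y : x * y = 1 -> V x \/ V y.
Proof.
have /valuation_ringsP[[V1 _ _] _ _ Vmul] := V_val => xy.
apply: contrapT => /not_orP[nx ny]; apply: (Vmul _ _ nx ny).
by rewrite xy.
Qed.

(** The product of [e] and [1 - e] is 0, which lies in [V], so one of the two lies in [V], and with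
    it the other. *)
Lemma valuation_idempotent e : e * e = e -> V e.
Proof.
have /valuation_ringsP[[V1 VB _] _ _ Vmul] := V_val => ee.
apply: contrapT => ne; have ne1 : ~ V (1 - e).
  by move=> Ve; apply: ne; rewrite -[e](subKr 1); exact: VB.
apply: (Vmul _ _ ne ne1); rewrite mulrBr mulr1 ee subrr.
exact: subring0.
Qed.

Lemma exists_regular_maximal_above (J : set Q) :
  is_ideal V J -> ~ J 1 -> regpart J !=set0 ->
  exists M, [/\ is_maximal V M, regpart M !=set0 & J `<=` M].
Proof.
move=> JI J1 [c [Jc rc]].
have [M Mmax JM] := exists_maximal_above Vring JI J1.
by exists M; split=> //; exists c; split=> //; exact: JM.
Qed.

(** If [x = a / b] lies outside [V], then the ideal [b V] is proper and contains the regular element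
    [b]. *)
Lemma exists_regular_maximal :
  exists M, is_maximal V M /\ regpart M !=set0.
Proof.
have /valuation_ringsP[_ _ VT _] := V_val; have [V1 VB VM] := Vring.
have [x nVx] : exists x, ~ V x.
  apply: contrapT => /forallNP all; apply: VT; apply/seteqP; split=> // x _.
  exact: contrapT (all x).
have [a [b [rb e]]] := Qr_fracP x.
have Vb : V (emb b) by apply: valuation_base; exists b.
have Va : V (emb a) by apply: valuation_base; exists a.
have [|[v Vv bv]||M [Mmax Mreg _]] :=
    @exists_regular_maximal_above [set z | exists2 v, V v & z = emb b * v].
- split.
  + by move=> _ [v Vv ->]; exact: VM.
  + by exists 0; rewrite ?mulr0 //; exact: subring0.
  + move=> _ _ [v Vv ->] [w Vw ->]; exists (v + w); last by rewrite mulrDr.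
    exact: subringD.
  + move=> a' _ Va' [v Vv ->]; exists (a' * v); first exact: VM.
    by rewrite mulrCA.
- apply: nVx; rewrite -[x]mul1r bv mulrAC e mulrC; exact: VM.
- exists (emb b); split; first by exists 1; rewrite ?mulr1.
  exact/invertible_regular/emb_regular_invertible.
- by exists M.
Qed.

Lemma regmaxP : is_maximal V (regmax V) /\ regpart (regmax V) !=set0.
Proof. exact: (xgetPex set0 exists_regular_maximal). Qed.

Lemma regmax_ideal : is_ideal V (regmax V).
Proof. by have [[]] := regmaxP. Qed.

Lemma regmax1 : ~ regmax V 1.
Proof. by have [/(maximal_avoiding1 Vring)[]] := regmaxP. Qed.

Hypotheses (R_noeth : noetherian R) (R_reduced : reduced R).

(* Adding a multiple of a common regular element supported where [m] vanishes
   makes [m] invertible without moving it into or out of the two ideals. *)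
Lemma regular_outside_ideal M M' c m : is_ideal V M -> is_ideal V M' ->
  M c -> M' c -> invertible c -> M m -> ~ M' m ->
  exists2 m1, invertible m1 & M m1 /\ ~ M' m1.
Proof.
move=> MI MI' Mc Mc' cinv Mm nMm.
have [e [y [ee me my]]] := Qr_idempotent m R_noeth R_reduced.
have Ve : V (1 - e).
  apply: valuation_idempotent.
  by rewrite mulrBr mulr1 mulrBl mul1r ee subrr subr0.
have [_ _ MD MM] := MI; have [_ _ MD' MM'] := MI'.
exists (m + c * (1 - e)); first exact: (invertible_complement ee me my).
split; first by apply: MD => //; rewrite mulrC; exact: MM.
move=> M'm1; apply: nMm; rewrite -[m](addrK (c * (1 - e))).
apply: MD' => //; apply: (idealN Vring MI').
by rewrite mulrC; exact: MM'.
Qed.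

(** Two distinct such ideals would contain invertible elements [x] and [y], each outside the other
    ideal. One of the quotients [x / y], [y / x] lies in [V], which puts [x] into [M'] or [y] into
    [M]. *)
Lemma regular_maximal_unique M M' :
  is_maximal V M -> regpart M !=set0 ->
  is_maximal V M' -> regpart M' !=set0 -> M = M'.
Proof.
move=> Mmax [c [Mc /Qr_regularP cinv]] Mmax' [c' [Mc' /Qr_regularP cinv']].
have /(maximal_avoiding1 Vring)[MI M1 max] := Mmax.
have /(maximal_avoiding1 Vring)[MI' M1' max'] := Mmax'.
have [sMM'|nsMM'] := pselect (M `<=` M'); first by rewrite (max M').
have [sM'M|nsM'M] := pselect (M' `<=` M); first by rewrite -(max' M).
have [m Mm nMm] : exists2 m, M m & ~ M' m.
  apply: contrapT => n; apply: nsMM' => x Mx.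
  by apply: contrapT => nx; apply: n; exists x.
have [m' Mm' nMm'] : exists2 m, M' m & ~ M m.
  apply: contrapT => n; apply: nsM'M => x Mx.
  by apply: contrapT => nx; apply: n; exists x.
have [MV _ _ MM] := MI; have [MV' _ _ MM'] := MI'.
have Mcc : M (c * c') by rewrite mulrC; apply: MM => //; exact: MV'.
have Mcc' : M' (c * c') by apply: MM' => //; exact: MV.
have ccinv := invertibleM cinv cinv'.
have [x [x' xx'] [Mx nMx]] :=
  regular_outside_ideal MI MI' Mcc Mcc' ccinv Mm nMm.
have [y [y' yy'] [My nMy]] :=
  regular_outside_ideal MI' MI Mcc' Mcc ccinv Mm' nMm'.
have [Vxy|Vyx] : V (x * y') \/ V (y * x').
  by apply: valuation_inv; rewrite mulrACA [y' * _]mulrC mulrACA xx' yy' mulr1.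
  case: nMx; have -> : x = (x * y') * y.
    by rewrite -mulrA [y' * y]mulrC yy' mulr1.
  exact: MM'.
case: nMy; have -> : y = (y * x') * x.
  by rewrite -mulrA [x' * x]mulrC xx' mulr1.
exact: MM.
Qed.

Lemma regmax_eq M : is_maximal V M -> regpart M !=set0 -> regmax V = M.
Proof.
by move=> Mmax Mreg; have [? ?] := regmaxP; exact: regular_maximal_unique.
Qed.

Lemma regular_ideal_sub_regmax (J : set Q) :
  is_ideal V J -> ~ J 1 -> regpart J !=set0 -> J `<=` regmax V.
Proof.
move=> JI J1 Jreg.
have [M [Mmax Mreg JM]] := exists_regular_maximal_above JI J1 Jreg.
by rewrite (regmax_eq Mmax Mreg).
Qed.

(** The elements of [V] that multiply [x] into [V] form an ideal with a regular element, a
    denominator of [x]. If [x] is not in [V], this ideal is proper, so it is contained in [regmax V]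
    and cannot contain [s]. *)
Lemma regmax_saturated s x : V s -> ~ regmax V s -> V (s * x) -> V x.
Proof.
move=> Vs ns Vsx; apply: contrapT => nx; apply: ns; have [V1 VB VM] := Vring.
apply: (@regular_ideal_sub_regmax [set t | V t /\ V (t * x)]) => //.
- split=> //= [t [] //||t u [Vt Vtx] [Vu Vux]|t u Vt [Vu Vux]].
  + by rewrite mul0r; split; exact: subring0.
  + by rewrite mulrDl; split; exact: subringD.
  + by rewrite -mulrA; split; exact: VM.
- by rewrite /= mul1r => -[].
- have [a [b [rb e]]] := Qr_fracP x.
  exists (emb b); split; last exact/invertible_regular/emb_regular_invertible.
  split; first by apply: valuation_base; exists b.
  by rewrite e; apply: valuation_base; exists a.
Qed.

End OneValuationRing.

(** * Existence of valuation rings *)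

Section Existence.
Variables (V : set Q) (Vring : is_subring V).

(* The values at [x] of the polynomials of degree at most [n] over [V]. *)
Fixpoint poly_le (x : Q) n : set Q :=
  if n is n'.+1 then
    [set z | exists2 p : Q * Q, V p.1 /\ poly_le x n' p.2 & z = p.1 + x * p.2]
  else V.

Lemma poly_leB x n d d' :
  poly_le x n d -> poly_le x n d' -> poly_le x n (d - d').
Proof.
have [V1 VB VM] := Vring; elim: n d d' => [|n IH] d d' /=; first exact: VB.
move=> [[a f] /= [Va Df] ->] [[a' f'] /= [Va' Df'] ->].
by exists (a - a', f - f') => /=; [split; [exact: VB | exact: IH] | ring].
Qed.

Lemma poly_le_mull x n a d : V a -> poly_le x n d -> poly_le x n (a * d).
Proof.
have [V1 VB VM] := Vring => Va; elim: n d => [|n IH] d /=; first exact: VM.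
move=> [[b f] /= [Vb Df] ->].
by exists (a * b, a * f) => /=; [split; [exact: VM | exact: IH] | ring].
Qed.

Lemma poly_le0 x n : poly_le x n 0.
Proof.
elim: n => [|n IH] /=; first exact: subring0.
by exists (0, 0); rewrite /= ?mulr0 ?addr0 //; split=> //; exact: subring0.
Qed.

Lemma poly_leD x n d d' :
  poly_le x n d -> poly_le x n d' -> poly_le x n (d + d').
Proof.
move=> Dd Dd'; rewrite -[d']opprK; apply: poly_leB => //.
by rewrite -sub0r; apply: poly_leB => //; exact: poly_le0.
Qed.

Lemma poly_leS x n d : poly_le x n d -> poly_le x n.+1 d.
Proof.
elim: n d => [|n IH] d.
  move=> Vd; exists (d, 0); rewrite /= ?mulr0 ?addr0 //.
  by split=> //; exact: subring0.
move=> [[a f] /= [Va Df] ->]; exists (a, f) => //=; split=> //; exact: IH.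
Qed.

Lemma poly_le_addn x n k d : poly_le x n d -> poly_le x (k + n) d.
Proof. by elim: k => [//|k IH] /IH; exact: poly_leS. Qed.

Lemma poly_le_mulx x n k d : poly_le x n d -> poly_le x (k + n) (x ^+ k * d).
Proof.
move=> Dd; elim: k => [|k IH]; first by rewrite mul1r.
exists (0, x ^+ k * d) => /=; first by split=> //; exact: subring0.
by rewrite exprS add0r mulrA.
Qed.

Lemma poly_leM x n m d d' :
  poly_le x n d -> poly_le x m d' -> poly_le x (n + m) (d * d').
Proof.
elim: n d => [|n IH] d Dd Dd'; first exact: poly_le_mull.
case: Dd => -[a f] [Va Df] ->; rewrite mulrDl; apply: poly_leD.
  by apply: (poly_le_addn n.+1); exact: poly_le_mull.
by rewrite -mulrA -[X in X * (_ * _)]expr1; apply: (poly_le_mulx 1); exact: IH.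
Qed.

Lemma poly_le_lead x n d : poly_le x n.+1 d ->
  exists f a, [/\ poly_le x n f, V a & d = f + a * x ^+ n.+1].
Proof.
elim: n d => [|n IH] d.
  by move=> [[a f] /= [Va Vf] ->]; exists a, f; rewrite expr1 mulrC.
move=> [[a g] [Va /IH[f [b [Df Vb /= ->]]]] ->]; exists (a + x * f), b.
by split=> //=; [exists (a, f) | rewrite !exprS; ring].
Qed.

(** Multiplication by [x ^+ n] turns [y ^+ i] into [(x * y) ^+ i * x ^+ (n - i)], and powers of
    [x * y] count as coefficients. *)
Lemma poly_le_reflect x y n d : V (x * y) -> poly_le y n d ->
  poly_le x n (x ^+ n * d).
Proof.
move=> Vxy; elim: n d => [|n IH] d; first by rewrite mul1r.
move=> [p [Va Df] ->].
have -> : x ^+ n.+1 * (p.1 + y * p.2) =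
    p.1 * x ^+ n.+1 + (x * y) * (x ^+ n * p.2).
  by rewrite exprS; ring.
apply: poly_leD; last by apply: poly_leS; apply: poly_le_mull => //; exact: IH.
have [V1 _ _] := Vring; apply: poly_le_mull => //.
by have := @poly_le_mulx x 0 n.+1 1 V1; rewrite addn0 mulr1.
Qed.

Variables (c ci : Q).
Hypotheses (Vc : V c) (c_ci : c * ci = 1).

(* If [ci] has degree at most [m <= n] in [y] and at most [n] in [x], the
   relation for [y] multiplied by [x ^+ n] eliminates the leading term of the
   relation for [x]. *)
Lemma poly_le_descent x y n m : V (x * y) -> (m <= n)%N ->
  poly_le x n.+1 ci -> poly_le y m.+1 ci -> poly_le x n ci.
Proof.
move=> Vxy lemn /poly_le_lead[f [a [Df Va ef]]] [[b g] /= [Vb Dg] eg].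
have key : poly_le x n (x ^+ n.+1 * (ci - b)).
  have -> : x ^+ n.+1 * (ci - b) =
      x * y * (x ^+ (n - m) * (x ^+ m * g)).
    by rewrite [_ ^+ (n - m) * _]mulrA -exprD subnK // exprS eg; ring.
  apply: poly_le_mull => //; rewrite -{1}(subnK lemn).
  by apply: poly_le_mulx; exact: (poly_le_reflect Vxy).
(* The identity arises from multiplying [ci - b] by [c * ci = 1] and writing that [ci] as
   [f + a * x ^+ n.+1]; note that [c * (ci - b) = 1 - c * b]. *)
have -> : ci = b + (1 - c * b) * f + (c * a) * (x ^+ n.+1 * (ci - b)).
  transitivity (b + c * (ci - b) * (f + a * x ^+ n.+1) +
     (1 - c * ci) * f); last by ring.
  transitivity (b + c * ci * (ci - b)); first by rewrite c_ci; ring.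
  by rewrite -ef [c * (ci - b) * ci]mulrAC c_ci; ring.
have [V1 VB VM] := Vring.
apply: poly_leD; last by apply: poly_le_mull => //; exact: VM.
apply: poly_leD; last by apply: poly_le_mull => //; apply: VB => //; exact: VM.
by rewrite -[n]addn0; exact: poly_le_addn.
Qed.

(** The descent lowers the larger of the two degrees. Once a degree is 0, [ci] lies in [V]. *)
Lemma poly_le_absurd x y n m : V (x * y) -> ~ V ci ->
  poly_le x n ci -> poly_le y m ci -> False.
Proof.
move=> Vxy nci; have [k] := ubnP (n + m); elim: k => // k IH in x y n m Vxy *.
case: n => [//|n]; case: m => [//|m] lek Dx Dy.
case: (leqP m n) => [lemn|/ltnW lenm].
  by apply: (IH x y n m.+1) => //; exact: (poly_le_descent Vxy lemn Dx Dy).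
rewrite mulrC in Vxy.
apply: (IH y x m n.+1) => //; last exact: (poly_le_descent Vxy lenm Dy Dx).
by rewrite addnC addSnnS.
Qed.

End Existence.

(* A maximal subring omitting the inverse of [c] is a valuation ring. *)
Lemma valuation_ring_exists c : c \in regular R -> ~ invertible c ->
  exists V, valuation_rings R V.
Proof.
move=> rc nc; have [ci c_ci] := emb_regular_invertible rc.
have [B1 BB BM] := base_subring R.
have nBci : ~ base R ci.
  move=> [d _ e]; apply: nc; exists d; apply: emb_inj.
  by rewrite rmorphM rmorph1 /= e.
(* The union with [base R] makes the empty chain yield [base R], which omits [ci] because [c] is not
   a unit of [R]. *)
pose P := [set X | is_subring (base R `|` X) /\ ~ (base R `|` X) ci].
have [C CP Ctot|M [[Vring nVci] Mmax]] := @Zorn_bigcup _ P.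
  have memC X x : C X -> (base R `|` X) x -> (base R `|` \bigcup_(X in C) X) x.
    by move=> CX [Bx|Xx]; [left | right; exists X].
  have pairC x y : (base R `|` \bigcup_(X in C) X) x ->
      (base R `|` \bigcup_(X in C) X) y ->
      (base R x /\ base R y) \/
      exists X, [/\ C X, (base R `|` X) x & (base R `|` X) y].
    move=> [Bx|[X CX Xx]] [By|[Y CY Yy]]; first by left.
    + by right; exists Y; split=> //; [left | right].
    + by right; exists X; split=> //; [right | left].
    + right; have [XY|YX] := Ctot X Y CX CY.
        by exists Y; split=> //; right => //; exact: XY.
      by exists X; split=> //; right => //; exact: YX.
  split; last by move=> [//|[X CX Xci]]; apply: (CP X CX).2; right.
  split; first by left.
  - move=> x y Ux Uy; have [[Bx By]|[X [CX Xx Xy]]] := pairC x y Ux Uy.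
      by left; exact: BB.
    by apply: (memC X) => //; have [[_ XB _] _] := CP X CX; exact: XB.
  - move=> x y Ux Uy; have [[Bx By]|[X [CX Xx Xy]]] := pairC x y Ux Uy.
      by left; exact: BM.
    by apply: (memC X) => //; have [[_ _ XM] _] := CP X CX; exact: XM.
pose V := base R `|` M; exists V.
have maxV W : is_subring W -> V `<=` W -> ~ W ci -> W `<=` V.
  move=> Wring VW nWci.
  have eBW : base R `|` W = W.
    by apply/setUidPr; apply: subset_trans VW; exact: subsetUl.
  apply: contrapT => nWV; apply: (Mmax W); last by split; rewrite eBW.
  split; first by apply: subset_trans VW; exact: subsetUr.
  by move=> WM; apply: nWV => w Ww; right; exact: WM.
(* Adjoining [x] gives a subring strictly larger than [V], which by maximality contains [ci]; so
   [ci] is a polynomial in [x] over [V]. *)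
have adj x : ~ V x -> exists n, poly_le V x n ci.
  move=> nVx; apply: contrapT => /forallNP nci; apply: nVx.
  have [V1 VB VM] := Vring.
  apply: (maxV (\bigcup_n poly_le V x n)).
  - split; first by exists 0%N.
      move=> y z [n _ Dy] [m _ Dz]; exists (n + m)%N => //.
      apply: poly_leB => //; first by rewrite addnC; exact: poly_le_addn.
      exact: poly_le_addn.
    move=> y z [n _ Dy] [m _ Dz]; exists (n + m)%N => //; exact: poly_leM.
  - by move=> v Vv; exists 0%N.
  - by move=> [n _ /nci].
  - exists 1%N => //; exists (0, 1); last by rewrite /= add0r mulr1.
    by split=> //; exact: subring0.
apply/valuation_ringsP; split=> //.
- exact: subsetUl.
- by move=> VT; apply: nVci; rewrite -/V VT.
- move=> x y /adj[n Dx] /adj[m Dy] Vxy.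
  apply: (poly_le_absurd Vring _ c_ci Vxy nVci Dx Dy).
  by left; exists c.
Qed.

End ValuationRings.

(** * Passage to the local rings *)

Section Localizations.
Variables (R : comPzRingType) (m : Max R).
Local Notation loc := (to_locmax m).
Local Notation phi := (Q_to_locmax m).
Local Notation emb := (@Loc.emb R (regular R)).
Local Notation embm := (@Loc.emb (locmax m) (regular (locmax m))).

Lemma max_val : Max R (val m).
Proof. exact: set_mem (valP m). Qed.

Lemma not_max1 : ~ val m 1.
Proof. exact: prime1 (maximal_is_prime max_val). Qed.

Lemma not_maxM s t : ~ val m s -> ~ val m t -> ~ val m (s * t).
Proof.
by move=> ns nt; have [_ _ mM] := maximal_is_prime max_val; move=> /mM[].
Qed.

Lemma awayP s : (s \in away m) <-> ~ val m s.
Proof.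
split=> [/negP ns ms|ns]; first by apply: ns; exact: mem_set.
by apply/negP => /set_mem.
Qed.

Lemma loc_invertible s : ~ val m s -> invertible (loc s).
Proof. by move=> /awayP; exact: loc_emb_invertible. Qed.

Lemma loc_eq0 a : loc a = 0 <-> exists s, ~ val m s /\ s * a = 0.
Proof.
split=> [/loc_emb_eq0[s /awayP ns sa]|[s [/awayP ns sa]]]; first by exists s.
by apply/loc_emb_eq0; exists s.
Qed.

Lemma locmax_fracP (x : locmax m) :
  exists a s, ~ val m s /\ loc s * x = loc a.
Proof. by have [a [s [/awayP ns e]]] := loc_fracP x; exists a, s. Qed.

Lemma phi_emb a : phi (emb a) = embm (loc a).
Proof. by rewrite /= Loc.map_mk; apply: Loc.eq_mk1; rewrite /= rmorph1. Qed.

Lemma phi_emb_invertible s : ~ val m s -> invertible (phi (emb s)).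
Proof.
by move=> /loc_invertible sinv; rewrite phi_emb; exact: invertible_rmorph.
Qed.

Lemma phi_ker x : phi x = 0 <-> exists s, ~ val m s /\ emb s * x = 0.
Proof.
split=> [px|[s [ns sx]]]; last first.
  have /invertible_regular rs := phi_emb_invertible ns.
  by apply: (regular_eq0 rs); rewrite -rmorphM sx rmorph0.
have [a [b [rb e]]] := Qr_fracP x.
have : embm (loc a) = 0 by rewrite -phi_emb -e rmorphM px mulr0.
rewrite -(rmorph0 embm) => /emb_inj/loc_eq0[s [ns sa]].
exists s; split=> //.
apply: (regular_eq0 (invertible_regular (emb_regular_invertible rb))).
by rewrite mulrCA e -rmorphM sa rmorph0.
Qed.

Hypotheses (R_noeth : noetherian R) (R_reduced : reduced R).

(** The complement [z] of [b] satisfies [b z = 0], so it vanishes in [locmax m], where [b] is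
    regular; adding it makes [b] regular without changing its image. *)
Lemma loc_regular_lift b : loc b \in regular (locmax m) ->
  exists2 b', b' \in regular R & loc b' = loc b.
Proof.
move=> rb; have [z bz rbz] := reduced_complement R_reduced b R_noeth.
exists (b + z) => //; rewrite rmorphD /= (_ : loc z = 0) ?addr0 //.
by apply: (regular_eq0 rb); rewrite -rmorphM bz rmorph0.
Qed.

Lemma phi_surj y : exists x, phi x = y.
Proof.
have [A' [B' [rB eB]]] := Qr_fracP y.
have [b [s [ns es]]] := locmax_fracP B'.
have [a [t [nt et]]] := locmax_fracP A'.
have [b' rb' eb'] : exists2 b', b' \in regular R & loc b' = loc b.
  apply: loc_regular_lift; rewrite -es rpredM //.
  exact/invertible_regular/loc_invertible.
have [t' rt' et'] : exists2 t', t' \in regular R & loc t' = loc t.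
  exact/loc_regular_lift/invertible_regular/loc_invertible.
have rbt : b' * t' \in regular R by rewrite rpredM.
have [d bd] := emb_regular_invertible rbt.
(* With [y = (a / t) / (b / s)], the preimage is [s a / (b t)], once [b] and [t] are replaced by
   regular elements with the same images. *)
exists (emb (s * a) * d).
have btinv : invertible (emb (b' * t')) by exists d.
have /invertible_regular/asboolP := invertible_rmorph phi btinv; apply;
  rewrite -rmorphM mulrCA bd mulr1 !phi_emb !rmorphM eb' et' -es -et.
rewrite !rmorphM /= -eB; set B := embm B'; set t0 := embm _; set s0 := embm _.
by move: B t0 s0 => B t0 s0; ring.
Qed.

(** Any preimage [x] becomes invertible after adding [1 - e] for its idempotent [e]; since [y] is
    regular, [e] maps to 1 and the added term to 0. *)
Lemma invertible_lift y : invertible y -> exists2 x, invertible x & phi x = y.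
Proof.
move=> yinv; have [x xy] := phi_surj y.
have [e [z [ee xe xz]]] := Qr_idempotent x R_noeth R_reduced.
exists (x + 1 * (1 - e)).
  by apply: (invertible_complement ee xe xz); exists 1; rewrite mulr1.
have /invertible_regular ry := yinv.
rewrite rmorphD rmorphM rmorphB !rmorph1 xy (_ : phi e = 1).
  by rewrite subrr mulr0 addr0.
apply/esym/eqP; rewrite -subr_eq0; apply/eqP; apply: (regular_eq0 ry).
by rewrite mulrBr mulr1 -xy -rmorphM xe subrr.
Qed.

(** Depth one provides a regular sequence of length one in the maximal ideal; its entry is regular
    because the span of the empty sequence is zero. *)
Lemma regular_locmax_nonunit : has_local_depth (locmax m) 1 ->
  exists2 c, c \in regular (locmax m) & ~ invertible c.
Proof.
move=> [M MaxM [[s [size_s sM [sreg _]]] _]].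
case: s size_s sM sreg => [//|c [|//]] _ sM sreg; exists c.
  apply: regular_of_mul_eq0 => a ca0; have := sreg 0%N isT a.
  rewrite /= ca0 => -[]; first by exists (fun=> 0); rewrite big_ord0.
  by move=> k ->; rewrite big_ord0.
have /maximal_is_prime Mprime : Max (locmax m) M by rewrite MaxM.
move=> [d cd]; apply: (prime1 Mprime); rewrite -cd mulrC.
by have [[_ _ _ MM] _ _] := Mprime; apply: MM => //; apply: sM; exact: mem_head.
Qed.

Lemma regular_in_maximal : has_local_depth (locmax m) 1 ->
  exists2 c, c \in regular R & val m c.
Proof.
move=> /regular_locmax_nonunit[c0 rc0 nc0].
have [c [t [nt e]]] := locmax_fracP c0.
have [|c' rc' ec'] := @loc_regular_lift c.
  by rewrite -e rpredM //; exact/invertible_regular/loc_invertible.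
exists c' => //; apply: contrapT => /loc_invertible; rewrite ec' -e mulrC.
by move=> /invertible_mull.
Qed.

(** Lifting the factors of a sum leaves an error [k] in the kernel of [phi]. By von Neumann
    regularity [k = k e'] with an idempotent [e'] also in the kernel; since [E] and [F] contain 0,
    this is one more admissible product. *)
Lemma mulset_preimage (E F : set (Qr (locmax m))) : E 0 -> F 0 ->
  mulset (phi @^-1` E) (phi @^-1` F) = phi @^-1` (mulset E F).
Proof.
move=> E0 F0; apply/seteqP; split=> [z [n [x [y [Ex Fy ->]]]]|z].
  exists n, (phi \o x), (phi \o y); split=> //.
  by rewrite rmorph_sum; apply: eq_bigr => i _; rewrite rmorphM.
move=> [n [x [y [Ex Fy e]]]].
have [x' ex] := choice (fun i => phi_surj (x i)).
have [y' ey] := choice (fun i => phi_surj (y i)).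
pose k := z - \sum_(i < n) x' i * y' i.
have pk : phi k = 0.
  rewrite rmorphB rmorph_sum e; apply/eqP; rewrite subr_eq0; apply/eqP.
  by apply: eq_bigr => i _; rewrite rmorphM ex ey.
have [e' [w [ee ke kw]]] := Qr_idempotent k R_noeth R_reduced.
pose u i := if unlift ord_max i is Some j then x' j else k.
pose v i := if unlift ord_max i is Some j then y' j else e'.
exists n.+1, u, v; split.
- by move=> i; rewrite /u /=; case: unliftP => [j _|_]; rewrite ?ex ?pk.
- move=> i; rewrite /v /=; case: unliftP => [j _|_]; rewrite ?ey //.
  by rewrite -kw rmorphM pk mul0r.
- rewrite big_ord_recr /= /u /v unlift_none ke.
  rewrite (eq_bigr (fun i => x' i * y' i)) ?subrKC //.
  move=> i _; rewrite (_ : widen_ord _ i = lift ord_max i) ?liftK //.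
  by apply: val_inj; rewrite /= /bump leqNgt ltn_ord.
Qed.

(** * Valuation rings pulled back from a localization *)

Section Preimage.
Variable W : set (Qr (locmax m)).
Hypothesis W_val : valuation_rings (locmax m) W.
Let Wring := valuation_subring W_val.
Local Notation V := (phi @^-1` W).

Lemma preimage_valuation_ring : valuation_rings R V.
Proof.
have [W1 WB WM] := Wring; have /valuation_ringsP[_ sW WT Wmul] := W_val.
apply/valuation_ringsP; split.
- split; first by rewrite /= rmorph1.
    by move=> x y; rewrite /= rmorphB; exact: WB.
  by move=> x y; rewrite /= rmorphM; exact: WM.
- move=> _ [a _ <-]; rewrite /preimage /mkset phi_emb.
  by apply: sW; exists (loc a).
- move=> VT; apply: WT; apply/seteqP; split=> // y _.
  by have [x <-] := phi_surj y; rewrite -[W _]/(V x) VT.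
- by move=> x y; rewrite /= rmorphM; exact: Wmul.
Qed.
Let Vring := valuation_subring preimage_valuation_ring.

(** By uniqueness it suffices that the preimage is a regular maximal ideal. A regular element lifts
    from [regmax W], and an ideal above the preimage contains the kernel of [phi], so if it is
    proper, so is its image. *)
Lemma regmax_preimage : regmax V = phi @^-1` regmax W.
Proof.
have [+ [c [Mc rc]]] := regmaxP W_val.
move=> /(maximal_avoiding1 Wring)[[MW M0 MD MM] M1 Mmax].
apply: (regmax_eq preimage_valuation_ring R_noeth R_reduced); last first.
  have /Qr_regularP/invertible_lift[d dinv e] := rc.
  by exists d; split; [rewrite /= e | exact: invertible_regular].
apply/(maximal_avoiding1 Vring); split.
- split; first by move=> x /MW.
  + by rewrite /= rmorph0.
  + by move=> x y; rewrite /= rmorphD; exact: MD.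
  + by move=> x y; rewrite /= rmorphM; exact: MM.
- by rewrite /= rmorph1.
- move=> I [IV I0 ID IM] MI I1; apply/seteqP; split=> // x Ix.
  rewrite /= -(Mmax (phi @` I)); first by exists x.
  + split; first by move=> _ [y /IV Vy <-].
    * by exists 0; rewrite ?rmorph0.
    * move=> _ _ [y Iy <-] [z Iz <-].
      by exists (y + z); rewrite ?rmorphD //; exact: ID.
    * move=> a _ Wa [z Iz <-]; have [a' ea] := phi_surj a.
      exists (a' * z); rewrite ?rmorphM ?ea //.
      by apply: IM => //; rewrite /= ea.
  + move=> y My; have [y' ey] := phi_surj y.
    by exists y' => //; apply: MI; rewrite /= ey.
  + move=> [y Iy py]; apply: I1; rewrite -[1](subrK y) addrC; apply: ID => //.
    by apply: MI; rewrite /= rmorphB rmorph1 py subrr.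
Qed.

Lemma regmax_exp_preimage k :
  regmax_exp V k = phi @^-1` regmax_exp W k.
Proof.
have W0 := subring0 Wring.
have iter0 (E : set (Qr (locmax m))) n : iter n (mulset E) W 0.
  case: n => [//|n]; exists 0%N, (fun=> 0), (fun=> 0).
  by split=> [[]|[]|] //; rewrite big_ord0.
have [_ M0 _ _] := regmax_ideal W_val.
(* Negative exponents require the inverse ideal to pull back as well; by surjectivity of [phi],
   every element of [regmax W] can be tested through a preimage. *)
have ecolon : colon V (regmax V) = phi @^-1` colon W (regmax W).
  rewrite regmax_preimage; apply/seteqP; split=> x Hx y /= Hy.
    have [y' ey] := phi_surj y.
    by rewrite -ey -rmorphM; apply: (Hx y'); rewrite /= ey.
  by rewrite rmorphM; exact: Hx.
case: k => n; rewrite /regmax_exp ?ecolon ?regmax_preimage.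
  by elim: n => [//|n IH]; rewrite !iterS IH mulset_preimage.
elim: n.+1 => [//|n' IH]; rewrite !iterS IH mulset_preimage //.
by move=> y _; rewrite mul0r.
Qed.

Lemma nu_preimage x : nu V x = nu W (phi x).
Proof.
have e : regmax_exp V = fun k => phi @^-1` regmax_exp W k.
  by apply/funext => k; exact: regmax_exp_preimage.
by rewrite /nu e.
Qed.

End Preimage.

End Localizations.

(** * Values and value semigroups *)

Section Values.
Variable R : comPzRingType.
Local Notation emb := (@Loc.emb R (regular R)).
Variable V : set (Qr R).
Hypothesis V_val : valuation_rings R V.
Let Vring := valuation_subring V_val.
Local Notation M := (regmax V).

Lemma mulset_mull (E F : set (Qr R)) a z :
  (forall y, F y -> F (a * y)) -> mulset E F z -> mulset E F (a * z).
Proof.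
move=> Fa [n [x [y [Ex Fy ->]]]]; exists n, x, (fun i => a * y i); split=> //.
  by move=> i; exact: Fa.
by rewrite mulr_sumr; apply: eq_bigr => i _; rewrite mulrCA.
Qed.

Lemma mulset_subset (E F F' : set (Qr R)) :
  F `<=` F' -> mulset E F `<=` mulset E F'.
Proof.
move=> FF' _ [n [x [y [Ex Fy ->]]]]; exists n, x, y; split=> // i.
exact: FF'.
Qed.

Lemma mem_mulset (E F : set (Qr R)) x y : E x -> F y -> mulset E F (x * y).
Proof.
by move=> Ex Fy; exists 1%N, (fun=> x), (fun=> y); split=> //; rewrite big_ord1.
Qed.

Lemma regmax_exp_mull k a x : V a -> regmax_exp V k x -> regmax_exp V k (a * x).
Proof.
have [V1 VB VM] := Vring => Va.
have iterM (E : set (Qr R)) n y :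
    iter n (mulset E) V y -> iter n (mulset E) V (a * y).
  elim: n y => [|n IH] y; first exact: VM.
  by rewrite !iterS; apply: mulset_mull => z; exact: IH.
by case: k => n; exact: iterM.
Qed.

Lemma regmax_exp_decr n n' : (n <= n')%N ->
  regmax_exp V (Posz n') `<=` regmax_exp V (Posz n).
Proof.
have [MV M0 MD MM] := regmax_ideal V_val.
have step k : iter k.+1 (mulset M) V `<=` iter k (mulset M) V.
  elim: k => [|k IH]; last by rewrite 2!iterS; exact: mulset_subset.
  move=> _ [l [x [y [Mx Vy ->]]]] /=; apply: MV.
  apply: (big_ind M) => // i _; rewrite mulrC; apply: MM => //; exact: Vy.
move=> /subnK <-; elim: (n' - n)%N => [//|k IH].
by apply: subset_trans IH; exact: step.
Qed.

Lemma regmax_exp1 : regmax_exp V 1 = M.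
Proof.
have [MV M0 MD MM] := regmax_ideal V_val; have [V1 _ _] := Vring.
apply/seteqP; split=> [_ [l [x [y [Mx Vy ->]]]]|x Mx].
  by apply: (big_ind M) => // i _; rewrite mulrC; apply: MM => //; exact: Vy.
by rewrite -[x]mulr1; exact: mem_mulset.
Qed.

Lemma sub_regmax_exp_Negz n : V `<=` regmax_exp V (Negz n).
Proof.
have [MV _ _ _] := regmax_ideal V_val.
rewrite /regmax_exp; elim: n.+1 => [//|k IH] x Vx.
rewrite iterS -[x]mul1r; apply: mem_mulset; last exact: IH.
by move=> y My; rewrite mul1r; exact: MV.
Qed.

Lemma nu_unitM u v x : V u -> V v -> u * v = 1 -> nu V (u * x) = nu V x.
Proof.
move=> Vu Vv uv.
have e k : regmax_exp V k (u * x) = regmax_exp V k x.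
  apply/propext; split; last exact: regmax_exp_mull.
  by move=> /(regmax_exp_mull Vv); rewrite mulrA [v * u]mulrC uv mul1r.
by rewrite /nu; congr (if _ then _ else Some (xget _ _));
  [congr `[< _ >]; apply: eq_forall => k | apply/funext => k /=];
  rewrite ?e //; congr (_ /\ _); apply: eq_forall => j; rewrite e.
Qed.

Lemma nu_eq k x : regmax_exp V k x ->
  (forall j, regmax_exp V j x -> (j <= k)%R) -> nu V x = Some k.
Proof.
move=> kx kmax; rewrite /nu; case: ifPn => [/asboolP all|_].
  by have := kmax _ (all (k + 1)); rewrite Num.Theory.gerDl.
congr Some; apply: xget_unique => // j [jx jmax].
by apply: Order.POrderTheory.le_anti; rewrite kmax // jmax.
Qed.

Lemma nu1 : nu V 1 = Some 0.
Proof.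
have [V1 _ _] := Vring.
apply: nu_eq => //; case=> [[|n]|n] //.
move=> /(@regmax_exp_decr 1); rewrite regmax_exp1.
by move=> /(_ isT)/(regmax1 V_val).
Qed.

(** The default 0 of [xget] in [nu] would also appear if no largest exponent existed, so a largest
    one has to be exhibited: it precedes the least [n] with [x] outside the [n]-th power, and it is
    positive if [x] lies in [M]. *)
Lemma nu0_not_regmax x : V x -> nu V x = Some 0 -> ~ M x.
Proof.
move=> Vx nux Mx.
have [all|/existsNP[k nk]] := pselect (forall k, regmax_exp V k x).
  by move: nux; rewrite /nu asboolT.
case: k nk => n nk; last by apply: nk; exact: sub_regmax_exp_Negz.
have ex : exists n, ~~ `[< regmax_exp V (Posz n) x >].
  by exists n; apply/asboolP.
case: (ex_minnP ex) => {nk ex}n /asboolP nk nmin.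
case: n nk nmin => [//|[|n]] nk nmin; first by apply: nk; rewrite regmax_exp1.
have nx : regmax_exp V (Posz n.+1) x.
  by apply: contrapT => /asboolPn /nmin; rewrite ltnn.
move: nux; rewrite (nu_eq nx) // => -[j|//].
move=> jx; rewrite lez_nat leqNgt; apply/negP => ltnj.
by apply: nk; exact: (regmax_exp_decr ltnj).
Qed.

Hypothesis dimR : has_krull_dim R 1.

(** The contraction is prime and contains the numerator of a regular element of [M]; in dimension
    one such a prime is maximal. *)
Lemma regmax_base_maximal : Max R [set r | M (emb r)].
Proof.
have [Mmax [q [Mq /Qr_regularP qinv]]] := regmaxP V_val.
have Vemb r : V (emb r) by apply: (valuation_base V_val); exists r.
have [MV M0 MD MM] := regmax_ideal V_val.
have [a [b [rb e]]] := Qr_fracP q.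
apply: (@regular_prime_maximal _ _ a dimR).
- split.
  + split=> //=.
      by move=> x y Mx My; rewrite rmorphD; exact: MD.
    by move=> r x _ Mx; rewrite rmorphM; apply: MM => //; exact: Vemb.
  + move=> MT; apply: (regmax1 V_val).
    by rewrite -(rmorph1 emb) -[M _]/([set r | M (emb r)] 1) MT.
  + move=> x y /=; rewrite rmorphM.
    by apply: (maximal_prime Vring Mmax); exact: Vemb.
- by rewrite /= -e; apply: MM => //; exact: Vemb.
- apply: invertible_emb; rewrite -e; apply: invertibleM => //.
  exact: emb_regular_invertible.
Qed.

End Values.

(** * Correspondence of valuation rings *)

Section Decomposition.
Variable R : comPzRingType.
Hypotheses (R_cm : one_dim_cohen_macaulay R) (R_reduced : reduced R).
Local Notation emb := (@Loc.emb R (regular R)).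

Let R_noeth : noetherian R. Proof. by have [] := R_cm. Qed.
Let R_dim : has_krull_dim R 1. Proof. by have [] := R_cm. Qed.
Let R_depth (m : Max R) : has_local_depth (locmax m) 1.
Proof. by have [] := R_cm. Qed.

Lemma Max_eq (M N : set R) : Max R M -> Max R N -> M `<=` N -> M = N.
Proof.
by move=> [_ _ max] [NI NT _] MN; have [->|NT'] := max N NI MN.
Qed.

(** Both sides are maximal ideals, so one inclusion suffices: an element outside [m] becomes a unit
    of [locmax m], hence is not in [regmax W]. *)
Lemma regmax_base_preimage (m : Max R) W : valuation_rings (locmax m) W ->
  [set r | regmax (Q_to_locmax m @^-1` W) (emb r)] = val m.
Proof.
move=> W_val; have V_val := preimage_valuation_ring R_noeth R_reduced W_val.
apply: Max_eq; [exact: regmax_base_maximal | exact: max_val |].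
move=> r /=; rewrite (regmax_preimage R_noeth R_reduced W_val) => Mr.
apply: contrapT => /loc_invertible[y ry]; apply: (regmax1 W_val).
have [_ _ _ MM] := regmax_ideal W_val.
rewrite -(rmorph1 (@Loc.emb _ (regular (locmax m)))) -ry rmorphM mulrC.
apply: MM; first by apply: (valuation_base W_val); exists y.
by rewrite -[regmax W _]/(regmax W (Loc.emb _ (to_locmax m r))) -phi_emb.
Qed.

Definition preimage_valuation (m : Max R) (W : valuation_rings (locmax m)) :
    valuation_rings R :=
  exist _ (Q_to_locmax m @^-1` val W)
    (mem_set (preimage_valuation_ring R_noeth R_reduced (set_mem (valP W)))).

(** A kernel element is killed by some [s] outside [m], and 0 is in [V], so saturation of [V] at
    [regmax V] applies. *)
Lemma kernel_sub_valuation V (m : Max R) : valuation_rings R V ->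
  val m = [set r | regmax V (emb r)] ->
  forall x, Q_to_locmax m x = 0 -> V x.
Proof.
move=> V_val em x /phi_ker[s [ns sx]]; have Vring := valuation_subring V_val.
apply: (regmax_saturated V_val R_noeth R_reduced (s := emb s)).
- by apply: (valuation_base V_val); exists s.
- by move: ns; rewrite em.
- by rewrite sx; exact: subring0.
Qed.

Lemma valuation_is_preimage V : valuation_rings R V ->
  exists (m : Max R) (W : set (Qr (locmax m))),
    valuation_rings (locmax m) W /\ V = Q_to_locmax m @^-1` W.
Proof.
move=> V_val; have Vring := valuation_subring V_val; have [V1 VB VM] := Vring.
have /valuation_ringsP[_ _ VT Vmul] := V_val.
pose m : Max R := SigSub (mem_set (regmax_base_maximal V_val R_dim)).
have kV := kernel_sub_valuation V_val (erefl (val m)).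
pose phi := Q_to_locmax m.
have VE : V = phi @^-1` (phi @` V).
  apply/seteqP; split=> [x Vx|x [y Vy exy]]; first by exists x.
  rewrite -[x](subrK y); apply: subringD => //.
  by apply: kV; rewrite rmorphB; apply/eqP; rewrite subr_eq0; apply/eqP/esym.
exists m, (phi @` V); split=> //; apply/valuation_ringsP; split.
- split; first by exists 1; rewrite ?rmorph1.
    move=> _ _ [x Vx <-] [y Vy <-].
    by exists (x - y); rewrite ?rmorphB //; exact: VB.
  move=> _ _ [x Vx <-] [y Vy <-].
  by exists (x * y); rewrite ?rmorphM //; exact: VM.
- move=> _ [x _ <-].
  have [q eq] := phi_surj R_noeth R_reduced (Loc.emb (regular (locmax m)) x).
  (* For [x = a / s] with lift [q], the difference of [s q] and [a] is in the kernel, so [s q] lies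
     in [V]; as [s] is outside [regmax V], so does [q]. *)
  exists q => //; have [a [s [ns e]]] := locmax_fracP x.
  apply: (regmax_saturated V_val R_noeth R_reduced (s := emb s)).
  + by apply: (valuation_base V_val); exists s.
  + by move: ns.
  + rewrite -[_ * _](subrK (emb a)); apply: subringD => //.
      by apply: kV; rewrite rmorphB rmorphM eq !phi_emb -rmorphM e subrr.
    by apply: (valuation_base V_val); exists a.
- by move=> WT; apply: VT; rewrite VE WT.
- move=> x' y'; have [x <-] := phi_surj R_noeth R_reduced x'.
  have [y <-] := phi_surj R_noeth R_reduced y'.
  rewrite -rmorphM => nx ny.
  rewrite -[(_ @` _) _]/((phi @^-1` (phi @` V)) (x * y)) -VE.
  by apply: Vmul => Vz; [apply: nx; exists x | apply: ny; exists y].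
Qed.

(** For injectivity, the preimage of [W] recovers [m] as the contraction of its regular maximal
    ideal, and then [W] by surjectivity of [Q_to_locmax m]. *)
Lemma preimage_valuation_bijection :
  valuation_rings_bijection preimage_valuation.
Proof.
split=> //; pose f (w : {m : Max R & valuation_rings (locmax m)}) :=
  preimage_valuation (tagged w).
have f_inj : injective f.
  move=> [m W] [m' W'] /(congr1 val) /= e.
  have em : m = m'.
    apply: val_inj; rewrite -(regmax_base_preimage (set_mem (valP W))).
    by rewrite -(regmax_base_preimage (set_mem (valP W'))) e.
  case: _ / em W' e => W' e; congr existT; apply: val_inj; apply/seteqP.
  by split=> y; have [x <-] := phi_surj R_noeth R_reduced y => Wx;
    [rewrite -[val W' _]/((Q_to_locmax m @^-1` val W') x) -e
    |rewrite -[val W _]/((Q_to_locmax m @^-1` val W) x) e].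
have f_surj V : exists w, f w = V.
  have [m [W [W_val eV]]] := valuation_is_preimage (set_mem (valP V)).
  exists (existT _ m (SigSub (mem_set W_val))); apply: val_inj.
  by rewrite /= -eV.
have [g fg] := choice f_surj.
by exists g => [w|V]; [apply: f_inj; rewrite fg | exact: fg].
Qed.

Lemma nu_phi_away (m : Max R) W s x : valuation_rings (locmax m) W ->
  ~ val m s -> nu W (Q_to_locmax m (emb s) * x) = nu W x.
Proof.
move=> W_val /loc_invertible[y sy].
apply: (nu_unitM W_val (v := Loc.emb _ y)).
- by apply: (valuation_base W_val); rewrite phi_emb; exists (to_locmax m s).
- by apply: (valuation_base W_val); exists y.
- by rewrite phi_emb -rmorphM sy rmorph1.
Qed.

(** If the numerator of [x] kills [c], then [c] vanishes in every [Qr (locmax m)], so the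
    annihilator of [c] lies in no maximal ideal and [c = 0]. *)
Lemma regular_of_locally_regular (x : Qr R) :
  (forall m, Q_to_locmax m x \in regular (Qr (locmax m))) ->
  x \in regular (Qr R).
Proof.
move=> xreg; have [a [b [rb e]]] := Qr_fracP x.
suff ra : a \in regular R.
  by apply: (@regular_mulr _ x (emb b)); rewrite mulrC e;
     exact/invertible_regular/emb_regular_invertible.
apply: regular_of_mul_eq0 => c ac; apply: contrapT => c0.
pose ann := [set r : R | r * c = 0].
have annI : is_ideal setT ann.
  split=> [//||r s rc sc|r s _ sc]; rewrite /ann /=; first by rewrite mul0r.
    by rewrite mulrDl rc sc addr0.
  by rewrite -mulrA sc mulr0.
have [|N Nmax annN] := exists_maximal_above (setT_subring R) annI.
  by rewrite /ann /= mul1r.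
pose n : Max R := SigSub (mem_set (Nmax : Max R N)).
have xc : x * emb c = 0.
  have /invertible_regular := emb_regular_invertible rb.
  by move=> /regular_eq0; apply; rewrite mulrA e -rmorphM ac rmorph0.
have /phi_ker[s [ns]] : Q_to_locmax n (emb c) = 0.
  by apply: (regular_eq0 (xreg n)); rewrite -rmorphM xc rmorph0.
rewrite -rmorphM -(rmorph0 emb) => /emb_inj sc.
by apply: ns; exact: annN.
Qed.

(** * Gluing elements of a fractional ideal *)

Section FractionalIdeal.
Variable E : set (Qr R).
Hypothesis E_frac : fractional_ideal E.

Lemma locideal_frac (m : Max R) x : locideal m E x ->
  exists s e, [/\ ~ val m s, E e & Q_to_locmax m (emb s) * x = Q_to_locmax m e].
Proof.
have [E0 ED EM _] := E_frac; move=> [n [y [z [Ey Bz ->]]]].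
pose P w := exists s e,
  [/\ ~ val m s, E e & Q_to_locmax m (emb s) * w = Q_to_locmax m e].
apply: (big_ind P) => [||i _].
- by exists 1, 0; rewrite mulr0 rmorph0; split=> //; exact: not_max1.
- move=> v w [s [e [ns Ee es]]] [t [f [nt Ef ft]]].
  exists (s * t), (emb t * e + emb s * f); split; first exact: not_maxM.
    by apply: ED; apply: EM => //; eexists.
  rewrite rmorphD !rmorphM -es -ft.
  set S := Q_to_locmax m (emb s); set T := Q_to_locmax m (emb t).
  by move: S T v w {es ft} => S T v w; ring.
- have [e Ee <-] := Ey i; have [r _ <-] := Bz i.
  have [a [s [ns es]]] := locmax_fracP r.
  exists s, (emb a * e); split=> //; first by apply: EM => //; exists a.
  by rewrite mulrCA phi_emb -rmorphM es rmorphM phi_emb mulrC.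
Qed.

(* The elements of [Q_R] whose image in [Q_{R_n}] lies in [n e R_n]. *)
Definition loc_multiples (n : Max R) (e : Qr R) : set (Qr R) :=
  [set q | exists t r, [/\ ~ val n t, val n r
    & Q_to_locmax n (emb t * q) = Q_to_locmax n (emb r * e)]].

Lemma loc_multiplesD n e q q' :
  loc_multiples n e q -> loc_multiples n e q' -> loc_multiples n e (q + q').
Proof.
move=> [t [r [nt nr etr]]] [t' [r' [nt' nr' etr']]].
have [[_ _ mD mM] _ _] := max_val n.
exists (t * t'), (t' * r + t * r'); split; first exact: not_maxM.
  by apply: mD; exact: mM.
transitivity (Q_to_locmax n (emb t') * Q_to_locmax n (emb t * q) +
   Q_to_locmax n (emb t) * Q_to_locmax n (emb t' * q')).
  by rewrite -!rmorphM -rmorphD; congr (Q_to_locmax n _); rewrite rmorphM; ring.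
rewrite etr etr' -!rmorphM -rmorphD; congr (Q_to_locmax n _).
by rewrite rmorphD !rmorphM; ring.
Qed.

Lemma loc_multiplesM n e a q :
  loc_multiples n e q -> loc_multiples n e (emb a * q).
Proof.
move=> [t [r [nt nr etr]]]; have [[_ _ _ mM] _ _] := max_val n.
exists t, (a * r); split=> //; first exact: mM.
by rewrite mulrCA rmorphM etr -rmorphM mulrA [emb (a * r)]rmorphM.
Qed.

Lemma loc_multiples0 n e : loc_multiples n e 0.
Proof.
have [[_ m0 _ _] _ _] := max_val n.
exists 1, 0; split=> //; first exact: not_max1.
by rewrite mulr0 [emb 0]rmorph0 mul0r.
Qed.

(** The multiplier is a power of an element [t] of [n] outside [m]: the ideal [J] of admissible [a]
    contains some [s * t ^+ k] with [s] outside [n], and such an [s] may be moved into the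
    denominator. *)
Lemma exists_multiplier (m n : Max R) (e : Qr R) : m <> n ->
  invertible (Q_to_locmax n e) ->
  exists2 a, ~ val m a & forall f, E f -> loc_multiples n e (emb a * f).
Proof.
move=> neq einv; have [E0 ED EM [_ [[d _ <-] rd] dE]] := E_frac.
have [t nt nmt] : exists2 t, val n t & ~ val m t.
  apply: contrapT => H; apply: neq; apply/esym/val_inj.
  apply: Max_eq; [exact: max_val | exact: max_val |].
  by move=> t nt; apply: contrapT => nmt; apply: H; exists t.
pose J := [set a | forall f, E f -> loc_multiples n e (emb a * f)].
have [[_ n0 nD nM] _ _] := max_val n.
have JI : is_ideal setT J.
  split=> //= [f _|a b Ja Jb f Ef|a b _ Jb f Ef].
  - by rewrite mul0r; exact: loc_multiples0.
  - by rewrite rmorphD mulrDl; apply: loc_multiplesD; [exact: Ja | exact: Jb].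
  - by rewrite rmorphM -mulrA; apply: loc_multiplesM; exact: Jb.
have [q qinv eq] := invertible_lift R_noeth R_reduced einv.
have [a [b [rb ab]]] := Qr_fracP q.
have ra : a \in regular R.
  apply: invertible_emb; rewrite -ab; apply: invertibleM => //.
  exact: emb_regular_invertible.
have [c rc nc] := regular_in_maximal R_noeth R_reduced (R_depth n).
(* Here [d] is a common denominator of [E], [q = a / b] an invertible lift of the image of [e], and
   [c] a regular element of [n]. If [d f = r], then [d a c f = r b c q], and [r b c] lies in [n]
   thanks to [c]. *)
have Jdac : J (d * a * c).
  move=> f Ef; have [r _ er] := dE f Ef.
  exists 1, (r * b * c); split; [exact: not_max1 | exact: nM |].
  transitivity (Q_to_locmax n (emb (r * b * c) * q)); last first.
    by rewrite !rmorphM eq.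
  rewrite rmorph1 mul1r; congr (Q_to_locmax n _).
  by rewrite !rmorphM /= -ab er; ring.
have rdac : d * a * c \in regular R.
  rewrite !rpredM //; apply: invertible_emb; exact/Qr_regularP.
have [k [s [ns Jst]]] :=
  power_in_regular_ideal R_dim JI Jdac rdac (max_val n) nt.
exists (t ^+ k).
  by elim: (k) => [|l IH]; [exact: not_max1 | rewrite exprS; exact: not_maxM].
move=> f Ef; have [u [r [nu nr eur]]] := Jst f Ef.
exists (u * s), r; split=> //; first exact: not_maxM.
by rewrite -eur; congr (Q_to_locmax n _); rewrite !rmorphM; ring.
Qed.

Hypothesis R_semilocal : semilocal R.

Lemma finite_Max : exists2 ms : seq (Max R), uniq ms & forall m, m \in ms.
Proof.
have /finite_seqP[s es] := R_semilocal.
exists (undup (pmap insub s)); first exact: undup_uniq.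
move=> m; rewrite mem_undup mem_pmap_sub.
have sub : Max R `<=` [set` s] by rewrite -es.
exact: sub (max_val m).
Qed.

Lemma exists_global_element (e : Max R -> Qr R) :
  (forall m, E (e m)) -> (forall m, invertible (Q_to_locmax m (e m))) ->
  exists2 x, regpart E x & forall m, exists t u,
    [/\ ~ val m t, ~ val m u
      & Q_to_locmax m (emb t * x) = Q_to_locmax m (emb u * e m)].
Proof.
move=> Ee einv; have [E0 ED EM _] := E_frac.
have [ms ms_uniq ms_all] := finite_Max.
have bE (p : Max R * Max R) : exists a, p.1 <> p.2 ->
    ~ val p.1 a /\ forall f, E f -> loc_multiples p.2 (e p.2) (emb a * f).
  (* On the diagonal 0 is a filler that lets [choice] produce a total function. *)
  have [->|neq] := pselect (p.1 = p.2); first by exists 0.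
  by have [a na aE] := exists_multiplier neq (einv p.2); exists a.
have [b bP] := choice bE.
pose a m := \prod_(n <- ms | n != m) b (m, n).
have na m : ~ val m (a m).
  apply: (big_ind (fun a => ~ val m a)); [exact: not_max1 | exact: not_maxM |].
  by move=> n /eqP nm; apply: (bP (m, n) _).1 => /esym.
have aE m n : m <> n -> loc_multiples n (e n) (emb (a m) * e m).
  move=> mn; rewrite /a -big_filter (bigD1_seq n) ?filter_uniq //=; last first.
    by rewrite mem_filter ms_all andbT; apply/eqP => /esym.
  rewrite rmorphM -mulrA; apply: (bP (m, n) _).2 => //.
  by apply: EM => //; eexists.
pose x := \sum_(m <- ms) emb (a m) * e m.
have xP m : exists t u, [/\ ~ val m t, ~ val m u
      & Q_to_locmax m (emb t * x) = Q_to_locmax m (emb u * e m)].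
  have [t [r [nt mr etr]]] : loc_multiples m (e m)
      (\sum_(n <- ms | n != m) emb (a n) * e n).
    apply: (big_ind (loc_multiples m (e m))).
    - exact: loc_multiples0.
    - exact: loc_multiplesD.
    - by move=> n /eqP nm; exact: aE.
  (* The unit factor is [(t a_m + r) / t]: [t a_m] is outside [m], while [r], collected from the
     terms with [n <> m], is inside. *)
  exists t, (t * a m + r); split=> //.
    have [[_ _ mD mM] _ _] := max_val m.
    move=> mta; apply: (not_maxM nt (na m)).
    rewrite -[t * a m](addrK r); apply: mD => //.
    by rewrite -mulN1r; exact: mM.
  rewrite /x (bigD1_seq m) //= mulrDr rmorphD etr -rmorphD.
  by congr (Q_to_locmax m _); rewrite rmorphD rmorphM; ring.
exists x => //; split.
  by apply: (big_ind E) => // m _; apply: EM => //; eexists.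
apply: regular_of_locally_regular => m.
have [t [u [nt nu etu]]] := xP m.
apply: (@regular_mulr _ _ (Q_to_locmax m (emb t))).
rewrite mulrC -rmorphM etu rmorphM; apply: invertible_regular.
by apply: invertibleM => //; exact: phi_emb_invertible.
Qed.

(** One inclusion sends [x] to its images. For the other, the local elements realizing the
    components of [g] are multiplied by units of the [locmax m] so as to come from [E], and then
    glued; both operations alter them only by units, which leaves the values unchanged. *)
Lemma Gamma_decomposition : Gamma E =
  prod_semigroup preimage_valuation (fun m => Gamma (locideal m E)).
Proof.
apply/seteqP; split=> [g [x [Ex rx] nux] m|g gP].
  exists (Q_to_locmax m x).
    split; last first.
      by apply/Qr_regularP/invertible_rmorph/Qr_regularP.
    rewrite -[Q_to_locmax m x]mulr1; apply: mem_mulset; first by exists x.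
    by exists 1; rewrite ?rmorph1.
  move=> W; rewrite -(nu_preimage R_noeth R_reduced (set_mem (valP W))).
  exact: (nux (preimage_valuation W)).
have H m : exists e, [/\ E e, invertible (Q_to_locmax m e) &
    forall W : valuation_rings (locmax m),
      nu (val W) (Q_to_locmax m e) = Some (g (preimage_valuation W))].
  have [y [/locideal_frac[s [e [ns Ee es]]] ry] nuy] := gP m.
  exists e; rewrite -es; split=> //.
    by apply: invertibleM; [exact: phi_emb_invertible | exact/Qr_regularP].
  by move=> W; rewrite nu_phi_away //; exact: set_mem (valP W).
have [e eP] := choice H.
have [||x Ex xP] := @exists_global_element e; try by move=> m; have [] := eP m.
exists x => // V.
have [m [W [W_val eV]]] := valuation_is_preimage (set_mem (valP V)).
pose W' : valuation_rings (locmax m) := SigSub (mem_set W_val).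
have -> : V = preimage_valuation W' by apply: val_inj.
have [t [u [nt nu etu]]] := xP m; have [_ _ nue] := eP m.
rewrite -nue [LHS](nu_preimage R_noeth R_reduced W_val).
by rewrite -(nu_phi_away _ W_val nt) -rmorphM etu rmorphM nu_phi_away.
Qed.

End FractionalIdeal.

(** * The ring itself and locality of its local value semigroups *)

Lemma base_regular_fractional_ideal : regular_fractional_ideal (base R).
Proof.
have Bring := base_subring R; have [B1 BB BM] := Bring.
have r1 : regpart (base R) 1 by split=> //; exact: rpred1.
split; last by exists 1.
split; [exact: subring0 | exact: subringD | exact: BM |].
by exists 1 => // x Bx; rewrite mul1r.
Qed.

Lemma locideal_base (m : Max R) : locideal m (base R) = base (locmax m).
Proof.
have Bring := base_subring (locmax m); have [B1 BB BM] := Bring.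
apply/seteqP; split=> [_ [n [x [y [Bx By ->]]]]|x Bx].
  apply: (big_ind (base (locmax m))); [exact: subring0 | exact: subringD |].
  move=> i _; apply: BM => //; have [_ [a _ <-] <-] := Bx i.
  by rewrite phi_emb; exists (to_locmax m a).
rewrite -[x]mul1r; apply: mem_mulset => //; exists 1; last by rewrite rmorph1.
by exists 1; rewrite ?rmorph1.
Qed.

(** If an element [a / s] has value 0 at one [W], then [a] lies outside the contraction of
    [regmax W], which is [m] whatever [W] is; so [a] is a unit of [locmax m], and the value is 0 at
    every [W]. *)
Lemma Gamma_local (m : Max R) : local_semigroup (Gamma (base (locmax m))).
Proof.
have Bring := base_subring (locmax m); have [B1 _ _] := Bring.
have valW (W : valuation_rings (locmax m)) := set_mem (valP W).
apply/seteqP; split=> [g [[_ [[x _ <-] rx] nux] [W gW]]|_ ->].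
  have [a [s [ns e]]] := locmax_fracP x.
  have es : Q_to_locmax m (emb s) * Loc.emb _ x = Q_to_locmax m (emb a).
    by rewrite !phi_emb -rmorphM e.
  have na : ~ val m a.
    rewrite -(regmax_base_preimage (valW W)) /=.
    rewrite (regmax_preimage R_noeth R_reduced (valW W)).
    apply: (nu0_not_regmax (valW W)).
      by apply: (valuation_base (valW W)); rewrite phi_emb; eexists.
    by rewrite -es nu_phi_away // nux gW.
  apply/funext => W'; apply: Some_inj; rewrite -nux.
  rewrite -(nu_phi_away _ (valW W') ns) es -[Q_to_locmax m _]mulr1.
  by rewrite nu_phi_away // nu1.
(* The zero vector has a zero component only if some valuation ring exists. *)
have [c rc nc] := regular_locmax_nonunit (R_depth m).
have [W W_val] := valuation_ring_exists rc nc.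
split; last by exists (SigSub (mem_set W_val)).
exists 1; first by split=> //; exact: rpred1.
by move=> W'; exact: nu1.
Qed.

End Decomposition.

Theorem theorem3p2p2 (R : comPzRingType)
    (R_cm : one_dim_cohen_macaulay R) (R_reduced : reduced R)
    (R_semilocal : semilocal R) :
  exists beta : forall m : Max R, valuation_rings (locmax m) -> valuation_rings R,
    [/\ valuation_rings_bijection beta,
        forall m : Max R, local_semigroup (Gamma (base (locmax m))),
        Gamma (base R) =
          prod_semigroup beta (fun m => Gamma (base (locmax m)))
      & forall E : set (Qr R), regular_fractional_ideal E ->
          Gamma E = prod_semigroup beta (fun m => Gamma (locideal m E))].
Proof.
exists (preimage_valuation R_cm R_reduced); split.
- exact: preimage_valuation_bijection.
- exact: Gamma_local.
- have [B_frac _] := base_regular_fractional_ideal R.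
  rewrite (Gamma_decomposition R_cm R_reduced B_frac R_semilocal).
  congr prod_semigroup; apply/functional_extensionality_dep => m.
  by rewrite locideal_base.
- by move=> E [E_frac _]; exact: Gamma_decomposition.
Qed.
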